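(* Let $n \geq 1$, let $Z_1,\dots,Z_n$ be independent standard normal random variables, let $\lambda_1 \geq \dots \geq \lambda_n > 0$ be real numbers, and put $W_0 = \lambda_1 Z_1^2 + \dots + \lambda_n Z_n^2$. Let $A_1 = \sum_{k=1}^n \lambda_k^2$ and $A_2 = \sum_{k=2}^n \lambda_k^2$. Then $$c_0\,(A_1 A_2)^{-1/4} \leq M(W_0) \leq c_1\,(A_1 A_2)^{-1/4},$$ where $$c_0 = \frac{1}{4e^2\sqrt{2\pi}} > 0.013, \qquad c_1 = \frac{2}{\sqrt{\pi}} < 1.129.$$
   Context: The random variable $W_0$ has a probability density function $p(x)$ that is continuous on the positive half-axis $x>0$ (and $W_0>0$ almost surely). The functional $M(W_0) = \sup_{x} p(x)$ denotes the supremum of this density over the positive half-axis, a value in $(0,+\infty]$. When $n=1$ one has $A_2=0$ (empty sum), and $(A_1A_2)^{-1/4}$ is understood as $+\infty$, so the claim then means $M(W_0)=+\infty$. *)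

(* Defs.v *)
From HB Require Import structures.
From mathcomp Require Import all_boot all_order all_algebra.
From mathcomp Require Import all_classical all_reals all_analysis.

Set Implicit Arguments.
Unset Strict Implicit.
Unset Printing Implicit Defensive.

Import Order.TTheory GRing.Theory Num.Theory.
Import numFieldNormedType.Exports.

Local Open Scope classical_set_scope.
Local Open Scope ring_scope.

Definition mutually_independent d (T : measurableType d) (R : realType)
    (P : probability T R) (I : finType) (X : I -> {RV P >-> R}) : Prop :=
  forall (J : {set I}) (B : I -> set R), (forall i, measurable (B i)) ->
    P (\bigcap_(i in [set` J]) (X i @^-1` B i)) =
    (\prod_(i in J) P (X i @^-1` B i))%E.

(* The second parameter of [normal_prob] is the standard deviation. *)
Definition standard_normal d (T : measurableType d) (R : realType)
    (P : probability T R) (X : {RV P >-> R}) : Prop :=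
  forall A : set R, measurable A -> distribution P X A = normal_prob 0 1 A.

Definition weighted_chi2 d (T : measurableType d) (R : realType)
    (P : probability T R) (n : nat) (lambda : 'I_n -> R)
    (Z : 'I_n -> {RV P >-> R}) : T -> R :=
  fun t => \sum_(k < n) lambda k * Z k t ^+ 2.

(* Continuity is only required on the open half-line, which determines the
   values of [p] there uniquely; on the rest of the line [p] is an arbitrary
   measurable version of the density. *)
Definition density_continuous_on_pos d (T : measurableType d) (R : realType)
    (P : probability T R) (X : T -> R) (p : R -> R) : Prop :=
  [/\ measurable_fun [set: R] p,
      forall x, 0 <= p x,
      forall A : set R, measurable A ->
        pushforward P X A = (\int[lebesgue_measure]_(x in A) (p x)%:E)%E &
      forall x, 0 < x -> {for x, continuous p}].

Definition max_density (R : realType) (p : R -> R) : \bar R :=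
  ereal_sup [set (p x)%:E | x in [set x : R | 0 < x]].

(* The convention 0 ^ (-1/4) = +oo has to be imposed, since [powR] maps 0 to 0
   for every nonzero exponent. *)
Definition inv_root4 (R : realType) (x : R) : \bar R :=
  if x == 0 then +oo%E else (x `^ (- 4^-1))%:E.

(* Main.v *)
Require Import Defs.
From HB Require Import structures.
From mathcomp Require Import all_boot all_order all_algebra.
From mathcomp Require Import all_classical all_reals all_analysis.
From mathcomp Require Import measurable_realfun ring lra.

(** Why the estimate holds.

Write T_l f (x) = E f(x + l Z^2) for a standard normal Z.  By independence
E f(W_0) is obtained by applying T_{lambda_1}, ..., T_{lambda_n} to f and
evaluating at 0 (weighted_chi2_mean).  Only nonnegative measurable f occur, so
Tonelli is the only exchange theorem involved, and these operators commute.
An upper bound for the density is phrased as density_le s M: under the law of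
the sum with coefficients s, translated arbitrarily, an interval of length h
has probability at most M h.

Upper bound.  Three facts are combined.

- No coefficient dominates (density_le_spread): if A = sum l^2 and every
  4 l^2 <= A then M = 1/(2 sqrt A).  The characteristic function of l Z^2 has
  modulus (1 + 4 t^2 l^2)^(-1/4), and Bernoulli's inequality
  1 + 4 t^2 l^2 >= (1 + A t^2)^(4 l^2/A) makes the modulus for the whole sum at
  most 1/(1 + A t^2), whose integral is explicit.  Fourier inversion is
  performed against the Poisson kernel e/(e^2 + u^2), the cosine transform of
  exp(-e t), and the trigonometric averages are tracked in real coordinates.

- Two coefficients l >= m (density_le_pair): M = 1/(2 sqrt(l m)).  In polar
  coordinates Z_1^2 + Z_2^2 has density exp(-x/2)/2, which gives m = l;
  shrinking one coefficient from l to m costs a factor sqrt(l/m).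

- One more coefficient l (density_le_cons): adding l Z^2, whose density is at
  most (2 pi l x)^(-1/2), to a variable with density bound M gives the bound
  2 sqrt M / sqrt(pi l).

If 4 lambda_1^2 <= A_1 the first fact applies to the whole sum.  Otherwise
A_1 < 4 lambda_1^2, and either A_2 <= 4 lambda_2^2 and the second fact
suffices, or the first fact bounds the sum without lambda_1 Z_1^2 and the third
one adds this term back.  The last case yields exactly 2/sqrt pi.

Lower bound.  Let V be the sum without its first term and let tau > 0 with
A_2 <= tau^2.  An exponential Chebyshev inequality gives |V - E V| <= 8 tau with
probability at least 1 - 2 exp(-15/8); independently lambda_1 Z_1^2 <= tau with
probability of order min(1, sqrt(tau/lambda_1)).  Thus an interval of length
17 tau carries enough mass (mass_lower).  The choice tau = sqrt A_2 gives the
estimate for n > 1, and tau -> 0 shows that the density is unbounded for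
n = 1. *)

Set Implicit Arguments.
Unset Strict Implicit.
Unset Printing Implicit Defensive.

Import Order.TTheory GRing.Theory Num.Theory.
Import numFieldNormedType.Exports.

Local Open Scope classical_set_scope.
Local Open Scope ring_scope.

(** * Averages over weighted squares of a standard normal variable *)

Section Chi2Mean.
Variable R : realType.
Local Notation N := (@normal_prob R 0 1).
Implicit Types (f g : R -> \bar R) (l x : R) (s : seq R).

Definition chi2_mean l f x : \bar R := (\int[N]_z f (x + l * z ^+ 2)%R)%E.

(** The head of the list is the outermost average: its variable is integrated last. *)
Definition chi2s_mean s f : R -> \bar R := foldr chi2_mean f s.

Lemma measurable_addsq l x : measurable_fun setT (fun z : R => x + l * z ^+ 2).
Proof. by apply: measurable_funD => //; apply: measurable_funM => //; exact: measurable_funX. Qed.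

Lemma measurable_chi2_arg l x f : measurable_fun setT f ->
  measurable_fun setT (fun z : R => f (x + l * z ^+ 2)).
Proof. by move=> mf; apply: measurableT_comp => //; exact: measurable_addsq. Qed.

Lemma chi2_mean_ge0 l f x : (forall y, (0 <= f y)%E) -> (0 <= chi2_mean l f x)%E.
Proof. by move=> f0; apply: integral_ge0. Qed.

(** Joint measurability in the starting point and in a parameter is what an
induction over the coefficients can carry; separate measurability is not. *)
Lemma measurable_chi2_mean_param d (T : measurableType d) l (F : R * T -> \bar R) :
  measurable_fun setT F -> (forall p, (0 <= F p)%E) ->
  measurable_fun setT (fun p : R * T => chi2_mean l (fun x => F (x, p.2)) p.1).
Proof.
move=> mF F0.
apply: (@measurable_fun_fubini_tonelli_F _ _ _ _ _ N
  (fun p : (R * T) * R => F (p.1.1 + l * p.2 ^+ 2, p.1.2))) => //.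
apply: measurableT_comp => //.
apply/measurable_fun_pairP; split => /=.
  apply: measurable_funD.
    by apply: (measurableT_comp measurable_fst measurable_fst).
  by apply: measurable_funM => //; apply: measurable_funX; exact: measurable_snd.
by apply: (measurableT_comp measurable_snd measurable_fst).
Qed.

Lemma measurable_chi2_mean l f : measurable_fun setT f ->
  (forall y, (0 <= f y)%E) -> measurable_fun setT (chi2_mean l f).
Proof.
move=> mf f0.
apply: (@measurable_fun_fubini_tonelli_F _ _ _ _ _ N
  (fun p : R * R => f (p.1 + l * p.2 ^+ 2))) => //.
apply: measurableT_comp => //; apply: measurable_funD => //.
by apply: measurable_funM => //; apply: measurable_funX; exact: measurable_snd.
Qed.

Lemma chi2_mean_le l f g : measurable_fun setT f -> measurable_fun setT g ->
  (forall y, (0 <= f y)%E) -> (forall y, (f y <= g y)%E) ->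
  forall x, (chi2_mean l f x <= chi2_mean l g x)%E.
Proof.
move=> mf mg f0 fg x; apply: ge0_le_integral => //; exact: measurable_chi2_arg.
Qed.

Lemma chi2_mean_cst l (c : \bar R) x : chi2_mean l (cst c) x = c.
Proof.
by rewrite /chi2_mean integral_cst//= [X in (_ * X)%E]probability_setT mule1.
Qed.

Lemma chi2_meanD l f g x : measurable_fun setT f -> measurable_fun setT g ->
  (forall y, (0 <= f y)%E) -> (forall y, (0 <= g y)%E) ->
  chi2_mean l (fun y => f y + g y)%E x = (chi2_mean l f x + chi2_mean l g x)%E.
Proof.
by move=> mf mg f0 g0; rewrite /chi2_mean ge0_integralD//; exact: measurable_chi2_arg.
Qed.

Lemma chi2_meanZ l f (c : R) x : measurable_fun setT f ->
  (forall y, (0 <= f y)%E) -> 0 <= c ->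
  chi2_mean l (fun y => c%:E * f y)%E x = (c%:E * chi2_mean l f x)%E.
Proof.
move=> mf f0 c0; rewrite /chi2_mean ge0_integralZl_EFin//.
exact: measurable_chi2_arg.
Qed.

Lemma chi2_mean_shift l f x y : chi2_mean l (fun u => f (y + u)) x = chi2_mean l f (y + x).
Proof. by rewrite /chi2_mean; under eq_integral do rewrite addrA. Qed.

(** Tonelli's theorem, with an arbitrary sigma-finite second measure: the
Gaussian one makes the averages commute, Lebesgue measure serves for
smoothing kernels. *)
Lemma chi2_mean_integral d (T : measurableType d)
    (m : {sigma_finite_measure set T -> \bar R}) l (F : R * T -> \bar R) x :
  measurable_fun setT F -> (forall p, (0 <= F p)%E) ->
  chi2_mean l (fun y => \int[m]_t F (y, t))%E x =
  (\int[m]_t chi2_mean l (fun y => F (y, t)) x)%E.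
Proof.
move=> mF F0; rewrite /chi2_mean.
rewrite (@fubini_tonelli _ _ _ _ _ N m
  (fun p : R * T => F (x + l * p.1 ^+ 2, p.2)))//.
apply: measurableT_comp => //.
apply/measurable_fun_pairP; split => //=.
apply: (measurableT_comp (measurable_addsq l x)).
  exact: measurable_fst.
exact: measurable_snd.
Qed.

Lemma chi2s_mean_ge0 s f x : (forall y, (0 <= f y)%E) -> (0 <= chi2s_mean s f x)%E.
Proof. by move=> f0; elim: s x => [|l s IH] x //=; exact: chi2_mean_ge0. Qed.

Lemma measurable_chi2s_mean s f : measurable_fun setT f ->
  (forall y, (0 <= f y)%E) -> measurable_fun setT (chi2s_mean s f).
Proof.
move=> mf f0; elim: s => [|l s IH] //=; apply: measurable_chi2_mean => // y.
exact: chi2s_mean_ge0.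
Qed.

Lemma chi2s_mean_le s f g : measurable_fun setT f -> measurable_fun setT g ->
  (forall y, (0 <= f y)%E) -> (forall y, (f y <= g y)%E) ->
  forall x, (chi2s_mean s f x <= chi2s_mean s g x)%E.
Proof.
move=> mf mg f0 fg; have g0 y : (0 <= g y)%E by exact: le_trans (fg y).
elim: s => [|l s IH] x //=; apply: chi2_mean_le => //;
  by [exact: measurable_chi2s_mean|move=> y; exact: chi2s_mean_ge0].
Qed.

Lemma chi2s_mean_cst s (c : \bar R) x : chi2s_mean s (cst c) x = c.
Proof.
elim: s x => [|l s IH] x //=; rewrite -[RHS](chi2_mean_cst l c x).
by congr chi2_mean; apply/funext => y; exact: IH.
Qed.

Lemma chi2s_meanD s f g x : measurable_fun setT f -> measurable_fun setT g ->
  (forall y, (0 <= f y)%E) -> (forall y, (0 <= g y)%E) ->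
  chi2s_mean s (fun y => f y + g y)%E x = (chi2s_mean s f x + chi2s_mean s g x)%E.
Proof.
move=> mf mg f0 g0; elim: s x => [|l s IH] x //=.
rewrite -chi2_meanD; try exact: measurable_chi2s_mean;
  try by move=> y; exact: chi2s_mean_ge0.
by congr chi2_mean; apply/funext => y; exact: IH.
Qed.

Lemma chi2s_meanZ s f (c : R) x : measurable_fun setT f ->
  (forall y, (0 <= f y)%E) -> 0 <= c ->
  chi2s_mean s (fun y => c%:E * f y)%E x = (c%:E * chi2s_mean s f x)%E.
Proof.
move=> mf f0 c0; elim: s x => [|l s IH] x //=.
rewrite -chi2_meanZ//; [|exact: measurable_chi2s_mean|by move=> y; exact: chi2s_mean_ge0].
by congr chi2_mean; apply/funext => y; exact: IH.
Qed.

Lemma chi2s_mean_shift s f x y :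
  chi2s_mean s (fun u => f (y + u)) x = chi2s_mean s f (y + x).
Proof.
elim: s x => [|l s IH] x //=; rewrite -chi2_mean_shift.
by congr chi2_mean; apply/funext => u; exact: IH.
Qed.

Lemma measurable_chi2s_mean_param d (T : measurableType d) s (F : R * T -> \bar R) :
  measurable_fun setT F -> (forall p, (0 <= F p)%E) ->
  measurable_fun setT (fun p : R * T => chi2s_mean s (fun x => F (x, p.2)) p.1).
Proof.
move=> mF F0; elim: s => [|l s IH] /=.
  by rewrite (_ : (fun _ => _) = F)//; apply/funext => -[].
apply: (measurable_chi2_mean_param l IH) => p.
by apply: chi2s_mean_ge0.
Qed.

Lemma measurable_chi2s_mean_snd d (T : measurableType d) s (F : R * T -> \bar R) x :
  measurable_fun setT F -> (forall p, (0 <= F p)%E) ->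
  measurable_fun setT (fun t : T => chi2s_mean s (fun y => F (y, t)) x).
Proof.
move=> mF F0; have := measurable_chi2s_mean_param s mF F0.
set G := (G in measurable_fun _ G) => mG.
by rewrite (_ : (fun t => _) = G \o pair x)//; exact: measurableT_comp.
Qed.

Lemma chi2s_mean_integral d (T : measurableType d)
    (m : {sigma_finite_measure set T -> \bar R}) s (F : R * T -> \bar R) x :
  measurable_fun setT F -> (forall p, (0 <= F p)%E) ->
  chi2s_mean s (fun y => \int[m]_t F (y, t))%E x =
  (\int[m]_t chi2s_mean s (fun y => F (y, t)) x)%E.
Proof.
move=> mF F0; elim: s x => [|l s IH] x //=.
rewrite -(chi2_mean_integral m l (F := fun p => chi2s_mean s (fun y => F (y, p.2)) p.1))/=.
- by congr chi2_mean; apply/funext => y; exact: IH.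
- exact: measurable_chi2s_mean_param.
- by move=> p; exact: chi2s_mean_ge0.
Qed.

Lemma chi2_mean_commute l s f x : measurable_fun setT f ->
  (forall y, (0 <= f y)%E) ->
  chi2s_mean s (chi2_mean l f) x = chi2_mean l (chi2s_mean s f) x.
Proof.
move=> mf f0.
rewrite /chi2_mean -/(chi2_mean l f) (chi2s_mean_integral N s (F := fun p => f (p.1 + l * p.2 ^+ 2)))//=.
  apply: eq_integral => z _; rewrite addrC -chi2s_mean_shift.
  by congr chi2s_mean; apply/funext => y; rewrite addrC.
apply: measurableT_comp => //; apply: measurable_funD => //.
by apply: measurable_funM => //; apply: measurable_funX; exact: measurable_snd.
Qed.

End Chi2Mean.

(** * Gaussian integrals as Lebesgue integrals *)

Section Lebesgue.
Variable R : realType.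
Local Notation mu := (@lebesgue_measure R).
Local Notation N := (@normal_prob R 0 1).
Local Notation phi := (@normal_pdf R 0 1).
Implicit Types (f g : R -> \bar R).

(** The normal density is the Radon-Nikodym derivative up to a null set. *)
Lemma ge0_integral_normal_prob f : measurable_fun setT f ->
  (forall x, (0 <= f x)%E) ->
  (\int[N]_x f x = \int[mu]_x (f x * (phi x)%:E))%E.
Proof.
move=> mf f0; have dom := @normal_prob_dominates R 0 1.
rewrite -(Radon_Nikodym_SigmaFinite.change_of_variables dom)//=.
have mphi : measurable_fun setT (EFin \o phi).
  by apply/measurable_EFinP; exact: measurable_normal_pdf.
have irn := Radon_Nikodym_SigmaFinite.f_integrable dom.
apply: ae_eq_integral => //.
- by apply: emeasurable_funM => //; exact: (measurable_int mu irn).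
- exact: emeasurable_funM.
- apply: ae_eqe_mul2l => /=.
  apply: integral_ae_eq => //= E _ mE.
  by rewrite -Radon_Nikodym_SigmaFinite.f_integral.
Qed.

(** Both sides are integrals against measures that agree on half-open
intervals, hence on all Borel sets. *)
Lemma ge0_integral_scale f (c : R) : 0 < c -> measurable_fun setT f ->
  (forall x, (0 <= f x)%E) ->
  (\int[mu]_x f x = c%:E * \int[mu]_x f (c * x)%R)%E.
Proof.
move=> c0 mf f0.
have mc : measurable_fun [set: measurableTypeR R] ( *%R c : _ -> measurableTypeR R).
  exact: measurable_funM.
pose k : {nonneg R} := NngNum (ltW c0).
have uniq A : measurable A -> mu A = mscale k (pushforward mu ( *%R c : _ -> measurableTypeR R)) A.
  apply: lebesgue_measure_unique => //= _ [[a b]] _ <-.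
  pose I : set R := `]a / c, b / c]%classic.
  transitivity (c%:E * mu I)%E; last first.
    rewrite /mscale /pushforward /=; congr (_ * mu _)%E.
    apply/seteqP; split=> x; rewrite /I /= !in_itv/= ltr_pdivrMr// ler_pdivlMr//;
    by rewrite mulrC.
  rewrite /I !lebesgue_measure_itv/= !lte_fin ltr_pM2r ?invr_gt0//.
  case: ifP => _; last by rewrite mule0.
  by rewrite -!EFinD -EFinM mulrBr !(mulrCA c) mulfV ?gt_eqF// !mulr1.
rewrite (eq_measure_integral (mscale k (pushforward mu ( *%R c : _ -> measurableTypeR R)))); last first.
  by move=> A mA _; exact: uniq.
rewrite ge0_integral_mscale//= ge0_integral_pushforward//=.
Qed.
End Lebesgue.

(** * Two squares: polar coordinates *)

Section Polar.
Variable R : realType.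
Local Notation mu := (@lebesgue_measure R).
Local Notation N := (@normal_prob R 0 1).
Local Notation phi := (@normal_pdf R 0 1).
Implicit Types (f g : R -> \bar R).

Lemma integral_cauchy : (\int[mu]_s ((1 + s ^+ 2)^-1)%:E = (@pi R)%:E)%E.
Proof.
have c1 : continuous (fun s : R => (1 + s ^+ 2)^-1).
  move=> s; apply: cvgV; first by rewrite gt_eqF// ltr_wpDr// sqr_ge0.
  by apply: cvgD; [exact: cvg_cst|exact: exprn_continuous].
rewrite ge0_symfun_integralT//; last 2 first.
- by move=> x; rewrite invr_ge0 addr_ge0// sqr_ge0.
- by move=> x /=; rewrite sqrrN.
rewrite -set_itvcy (@ge0_continuous_FTC2y _ _ (@atan R) 0 (pi / 2))//.
- by rewrite atan0 sube0 -EFinM mulrC divfK.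
- by move=> x _; rewrite invr_ge0 addr_ge0// sqr_ge0.
- exact: continuous_subspaceT.
- exact: cvgy_atan.
- by apply: cvg_at_right_filter; exact: continuous_atan.
- by move=> x _; exact: derive1_atan.
Qed.

Lemma normal_pdf01E (x : R) : phi x = (Num.sqrt (pi *+ 2))^-1 * expR (- x ^+ 2 / 2).
Proof.
rewrite normal_pdfE ?oner_neq0//= /normal_peak /normal_fun expr1n mul1r subr0.
by rewrite mulr2n.
Qed.

Lemma ge0_even_integral (g : R -> \bar R) : measurable_fun setT g ->
  (forall x, (0 <= g x)%E) -> (forall x, g (- x) = g x) ->
  (\int[mu]_x g x = 2%:E * \int[mu]_(x in `[0%R, +oo[) g x)%E.
Proof.
move=> mg g0 gN.
rewrite -(setUv `[0%R, +oo[%classic) ge0_integral_setU//=; last 3 first.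
- exact: measurableC.
- by rewrite setUv.
- exact/disj_setPCl.
rewrite mule_natl mule2n; congr (_ + _)%E.
rewrite setCitvr ge0_integration_by_substitution0//.
under [RHS]eq_integral do rewrite gN.
by rewrite integral_itv_bndo_bndc//; exact: measurable_funTS.
Qed.

Let wgt (u : R) := `|u| * (pi *+ 2)^-1 * expR (- u ^+ 2 / 2).

Let wgt_ge0 u : 0 <= wgt u.
Proof. by rewrite /wgt !mulr_ge0 ?expR_ge0// invr_ge0 mulrn_wge0// pi_ge0. Qed.

Let measurable_wgt : measurable_fun setT wgt.
Proof.
apply: measurable_funM; first by apply: measurable_funM => //; exact: normr_measurable.
apply: measurableT_comp => //; apply: measurable_funM => //.
by apply: measurable_funN; exact: measurable_funX.
Qed.

Let phiM_wgt (y t : R) :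
  `|y| * (phi (`|y| * t) * phi y) =
  (Num.sqrt (1 + t ^+ 2))^-1 * wgt (Num.sqrt (1 + t ^+ 2) * y).
Proof.
have k0 : 0 < 1 + t ^+ 2 by rewrite ltr_wpDr// sqr_ge0.
rewrite !normal_pdf01E /wgt normrM (ger0_norm (sqrtr_ge0 _)) !mulrA mulVf ?gt_eqF ?sqrtr_gt0//.
rewrite mul1r.
have hc : (Num.sqrt (pi *+ 2))^-1 * (Num.sqrt (pi *+ 2))^-1 = (pi *+ 2)^-1 :> R.
  by rewrite -invfM -expr2 sqr_sqrtr// mulrn_wge0// pi_ge0.
rewrite -hc.
have -> : expR (- (Num.sqrt (1 + t ^+ 2) * y) ^+ 2 / 2) =
    expR (- (`|y| * t) ^+ 2 / 2) * expR (- y ^+ 2 / 2).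
  rewrite -expRD !exprMn real_normK ?num_real// sqr_sqrtr ?ltW//.
  by congr expR; field.
ring.
Qed.

(** The substitution z = |y| t turns the Gaussian weight into a function of
y^2 (1 + t^2) only.  Rescaling y by sqrt(1 + t^2) then splits the double
integral into the integral of 1/(1 + t^2), equal to pi, and a radial integral. *)
Lemma normal_polar f : measurable_fun setT f -> (forall x, (0 <= f x)%E) ->
  (\int[N]_y \int[N]_z f (y ^+ 2 + z ^+ 2)%R =
   \int[mu]_(r in `[0%R, +oo[) (f (r ^+ 2)%R * (r * expR (- r ^+ 2 / 2))%:E))%E.
Proof.
move=> mf f0.
pose H (p : R * R) := (f (p.1 ^+ 2 * (1 + p.2 ^+ 2))%R *
  (`|p.1| * (phi (`|p.1| * p.2) * phi p.1))%:E)%E.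
have mphi : measurable_fun setT phi by exact: measurable_normal_pdf.
have mH : measurable_fun setT H.
  apply: emeasurable_funM.
    apply: measurableT_comp => //; apply: measurable_funM.
      by apply: measurable_funX.
    by apply: measurable_funD => //; apply: measurable_funX; exact: measurable_snd.
  have mabs : measurable_fun setT (fun p : R * R => `|p.1|).
    by apply: (measurableT_comp (@normr_measurable R setT)).
  apply/measurable_EFinP; apply: measurable_funM => //.
  apply: measurable_funM; apply: (measurableT_comp mphi) => //.
  by apply: measurable_funM => //; exact: measurable_snd.
have H0 p : (0 <= H p)%E.
  by rewrite mule_ge0// lee_fin !mulr_ge0// normal_pdf_ge0.
pose G (u : R) := (f (u ^+ 2)%R * (wgt u)%:E)%E.
have mG : measurable_fun setT G.
  apply: emeasurable_funM; last exact/measurable_EFinP.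
  by apply: measurableT_comp => //; exact: measurable_funX.
have G0 u : (0 <= G u)%E by rewrite mule_ge0// lee_fin.
transitivity (\int[mu]_y \int[mu]_t H (y, t))%E.
  have mN : measurable_fun setT (fun y : R => \int[N]_z f (y ^+ 2 + z ^+ 2)%R)%E.
    apply: (@measurable_fun_fubini_tonelli_F _ _ _ _ _ N
      (fun p : R * R => f (p.1 ^+ 2 + p.2 ^+ 2))) => //.
    apply: (measurableT_comp mf); apply: measurable_funD; apply: measurable_funX.
      exact: measurable_fst.
    exact: measurable_snd.
  rewrite ge0_integral_normal_prob//; last by move=> y; exact: integral_ge0.
  apply: ae_eq_integral => //.
  - by apply: emeasurable_funM => //; exact/measurable_EFinP.
  - exact: measurable_fun_fubini_tonelli_F.
  exists [set 0]; split; [exact: measurable_set1|exact: lebesgue_measure_set1|].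
  move=> y /=; apply: contra_notP => /eqP y0 _.
  have y_gt0 : 0 < `|y| by rewrite normr_gt0.
  have mfy : measurable_fun setT (fun z : R => f (y ^+ 2 + z ^+ 2)).
    by apply: (measurableT_comp mf); apply: measurable_funD => //; exact: measurable_funX.
  have mfy' : measurable_fun setT (fun z : R => f (y ^+ 2 + z ^+ 2)%R * (phi z)%:E)%E.
    by apply: emeasurable_funM => //; exact/measurable_EFinP.
  have fy0 z : (0 <= f (y ^+ 2 + z ^+ 2)%R * (phi z)%:E)%E.
    by rewrite mule_ge0// lee_fin normal_pdf_ge0.
  rewrite ge0_integral_normal_prob// (ge0_integral_scale y_gt0)//.
  rewrite -muleA muleCA muleC -ge0_integralZl//; last 2 first.
  - by apply: (measurableT_comp mfy'); exact: measurable_funM.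
  - by rewrite -EFinM lee_fin mulr_ge0// normal_pdf_ge0.
  apply: eq_integral => t _; rewrite /H/=.
  rewrite muleCA -!EFinM; congr (f _ * _%:E)%E; last by ring.
  by rewrite exprMn real_normK ?num_real//; ring.
rewrite fubini_tonelli//.
transitivity (\int[mu]_t (((1 + t ^+ 2)^-1)%:E * \int[mu]_y G y))%E.
  apply: eq_integral => t _.
  have k0 : 0 < 1 + t ^+ 2 by rewrite ltr_wpDr// sqr_ge0.
  have q0 : 0 < Num.sqrt (1 + t ^+ 2) by rewrite sqrtr_gt0.
  rewrite (ge0_integral_scale q0 mG)// muleA -EFinM -{1}(sqr_sqrtr (ltW k0)).
  rewrite expr2 invfM mulfVK ?gt_eqF//.
  rewrite -ge0_integralZl//; last first.
    by apply: (measurableT_comp mG); exact: measurable_funM.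
  apply: eq_integral => y _; rewrite /H /G/= muleCA -EFinM phiM_wgt.
  by congr (f _ * _)%E; rewrite exprMn sqr_sqrtr ?ltW// mulrC.
have IG0 : (0 <= \int[mu]_y G y)%E by apply: integral_ge0.
rewrite ge0_integralZr//; last 2 first.
- apply/measurable_EFinP; apply: continuous_measurable_fun => t.
  apply: cvgV; first by rewrite gt_eqF// ltr_wpDr// sqr_ge0.
  by apply: cvgD; [exact: cvg_cst|exact: exprn_continuous].
- by move=> t _; rewrite lee_fin invr_ge0 addr_ge0// sqr_ge0.
rewrite integral_cauchy ge0_even_integral//; last first.
  by move=> x; rewrite /G /wgt sqrrN normrN.
rewrite muleA -ge0_integralZl//; last 2 first.
- exact: measurable_funTS.
- by rewrite -EFinM lee_fin mulr_ge0// pi_ge0.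
apply: eq_integral => r; rewrite inE/= in_itv/= andbT => r0.
rewrite /G muleCA; congr (_ * _)%E; rewrite -!EFinM /wgt ger0_norm//.
congr EFin; rewrite -[pi *+ 2]mulr_natr.
have := @pi_gt0 R; move: (pi : R) => p p0; field.
by rewrite gt_eqF.
Qed.
End Polar.

Section Pair.
Variable R : realType.
Local Notation mu := (@lebesgue_measure R).
Local Notation N := (@normal_prob R 0 1).
Local Notation phi := (@normal_pdf R 0 1).
Implicit Types (f g : R -> \bar R) (l m x : R).

Lemma chi2_mean_polar l f x : measurable_fun setT f -> (forall y, (0 <= f y)%E) ->
  chi2_mean l (chi2_mean l f) x =
  (\int[mu]_(r in `[0%R, +oo[) (f (x + l * r ^+ 2)%R * (r * expR (- r ^+ 2 / 2))%:E))%E.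
Proof.
move=> mf f0.
have mg : measurable_fun setT (fun u : R => f (x + l * u)).
  by apply: (measurableT_comp mf); apply: measurable_funD.
rewrite -(normal_polar mg (fun u => f0 _)).
rewrite /chi2_mean; apply: eq_integral => y _; apply: eq_integral => z _.
by rewrite mulrDr addrA.
Qed.

(** The density of m Z^2 is at most sqrt(l/m) times that of l Z^2. *)
Lemma chi2_mean_scale l m f x : 0 < m -> m <= l -> measurable_fun setT f ->
  (forall y, (0 <= f y)%E) ->
  (chi2_mean m f x <= (Num.sqrt (l / m))%:E * chi2_mean l f x)%E.
Proof.
move=> m0 ml mf f0; have l0 : 0 < l by exact: lt_le_trans ml.
have q0 : 0 < Num.sqrt (l / m) by rewrite sqrtr_gt0 divr_gt0.
have mphi : measurable_fun setT phi by exact: measurable_normal_pdf.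
have marg k : measurable_fun setT (fun z : R => f (x + k * z ^+ 2)%R * (phi z)%:E)%E.
  by apply: emeasurable_funM; [exact: measurable_chi2_arg|exact/measurable_EFinP].
have arg0 k (z : R) : (0 <= f (x + k * z ^+ 2)%R * (phi z)%:E)%E.
  by rewrite mule_ge0// lee_fin normal_pdf_ge0.
rewrite /chi2_mean.
rewrite (ge0_integral_normal_prob (measurable_chi2_arg m x mf) (fun z => f0 _)).
rewrite (ge0_integral_normal_prob (measurable_chi2_arg l x mf) (fun z => f0 _)).
rewrite (ge0_integral_scale q0 (marg m) (arg0 m)).
apply: lee_wpmul2l; first by rewrite lee_fin ltW.
apply: ge0_le_integral => //.
  by apply: (measurableT_comp (marg m)); exact: measurable_funM.
  exact: marg.
move=> z _.
have -> : x + m * (Num.sqrt (l / m) * z) ^+ 2 = x + l * z ^+ 2.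
  rewrite exprMn sqr_sqrtr ?divr_ge0 ?(ltW m0) ?(ltW l0)//.
  by rewrite [_ * (l / m * _)]mulrA (mulrCA m) divff ?gt_eqF// mulr1.
apply: lee_wpmul2l => //; rewrite lee_fin !normal_pdf01E.
have c0 : 0 < (Num.sqrt (pi *+ 2))^-1 :> R.
  by rewrite invr_gt0 sqrtr_gt0 mulrn_wgt0// pi_gt0.
rewrite ler_pM2l// ler_expR ler_pM2r// lerN2 exprMn sqr_sqrtr; last first.
  by rewrite divr_ge0 ?(ltW m0) ?(ltW l0).
by rewrite ler_peMl ?sqr_ge0// ler_pdivlMr// mul1r.
Qed.

(** The primitive of r is r^2/2, so the r with x + l r^2 in [a, b]
contribute at most (b - a)/(2 l). *)
Lemma integral_itv_sq l a b x : 0 < l -> a <= b ->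
  (\int[mu]_(r in `[0%R, +oo[) (\1_`[a, b] (x + l * r ^+ 2) * r)%:E <=
   ((b - a) / (l * 2))%:E)%E.
Proof.
move=> l0 ab.
have l2 : 0 < l * 2 by rewrite mulr_gt0.
pose al := Num.sqrt ((a - x) / l); pose be := Num.sqrt ((b - x) / l).
have albe : al <= be by rewrite ler_wsqrtr// ler_pM2r ?invr_gt0// lerD2r.
have al0 : 0 <= al by rewrite sqrtr_ge0.
have [bx|xb] := ltP b x.
  rewrite integral0_eq ?lee_fin ?divr_ge0 ?subr_ge0 ?(ltW l2)// => r _.
  rewrite indicE memNset ?mul0r//= in_itv/= => /andP[_].
  by apply/negP; rewrite -ltNge (lt_le_trans bx)// lerDl mulr_ge0 ?sqr_ge0// ltW.
have be2 : be ^+ 2 = (b - x) / l by rewrite sqr_sqrtr// divr_ge0 ?subr_ge0// ltW.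
have al2 : (a - x) / l <= al ^+ 2.
  have [ax|ax] := leP 0 ((a - x) / l); first by rewrite sqr_sqrtr.
  by rewrite (le_trans (ltW ax))// sqr_ge0.
apply: (@le_trans _ _ (\int[mu]_(r in `[al, be]) r%:E)%E).
  rewrite [leLHS](_ : _ = \int[mu]_(r in `[0%R, +oo[) ((fun r => (r%:E)) \_ `[al, be]) r)%E; last first.
    apply: eq_integral => r; rewrite inE/= in_itv/= andbT => r0.
    rewrite patchE indicE.
    have -> : (x + l * r ^+ 2 \in `[a, b]%classic) = (r \in `[al, be]%classic).
      apply/idP/idP; rewrite !inE/= !in_itv/= => /andP[h1 h2].
        have h1' : (a - x) / l <= r ^+ 2 by rewrite ler_pdivrMr// lerBlDl mulrC.
        have h2' : r ^+ 2 <= (b - x) / l by rewrite ler_pdivlMr// lerBrDl mulrC.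
        by rewrite -[r]ger0_norm// -sqrtr_sqr !ler_wsqrtr.
      have h1' : al ^+ 2 <= r ^+ 2 by rewrite ler_sqr.
      have h2' : r ^+ 2 <= be ^+ 2 by rewrite ler_sqr ?nnegrE// (le_trans al0).
      move: (le_trans al2 h1'); rewrite ler_pdivrMr// lerBlDl mulrC => ->.
      by move: h2'; rewrite be2 ler_pdivlMr// lerBrDl mulrC => ->.
    by case: ifP => _; rewrite ?mul1r ?mul0r.
  rewrite -integral_mkcondr setIidr//.
  by move=> r /=; rewrite !in_itv/= andbT => /andP[+ _]; exact: le_trans.
move: albe; rewrite le_eqVlt => /predU1P[<-|albe].
  by rewrite set_itv1 integral_set1 lee_fin divr_ge0 ?subr_ge0// ltW.
rewrite (@continuous_FTC2 _ id (fun r => r ^+ 2 / 2))//; last 3 first.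
- by apply: continuous_subspaceT => r; exact: cvg_id.
- split => [r _||].
  + exact: ex_derive.
  + apply: cvg_at_right_filter; apply: cvgM; last exact: cvg_cst.
    exact: exprn_continuous.
  + apply: cvg_at_left_filter; apply: cvgM; last exact: cvg_cst.
    exact: exprn_continuous.
- by move=> r _; rewrite derive1E derive_val /GRing.scale/=; field.
rewrite -EFinB lee_fin be2 -mulrBl invfM mulrA ler_pM2r ?invr_gt0//.
rewrite lerBlDr -lerBlDl -mulrBl (_ : _ - _ - _ = a - x)//.
by ring.
Qed.

Lemma measurable_EFin_indic_itv a b : measurable_fun setT (fun y : R => (\1_`[a, b] y)%:E : \bar R).
Proof. by apply/measurable_EFinP; exact: measurable_indic. Qed.

(** After replacing m by l the squared radius is exponential, and its weight
r exp(-r^2/2) is at most r. *)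
Lemma chi2_mean_pair_itv l m a b x : 0 < m -> m <= l -> a <= b ->
  (chi2_mean l (chi2_mean m (fun y => (\1_`[a, b] y)%:E)) x <=
   ((2 * Num.sqrt (l * m))^-1 * (b - a))%:E)%E.
Proof.
move=> m0 ml ab; have l0 : 0 < l by exact: lt_le_trans ml.
pose I (y : R) : \bar R := (\1_`[a, b] y)%:E.
have mI : measurable_fun setT I by exact: measurable_EFin_indic_itv.
have I0 y : (0 <= I y)%E by rewrite lee_fin.
have mT k : measurable_fun setT (chi2_mean k I) by exact: measurable_chi2_mean.
have T0 k y : (0 <= chi2_mean k I y)%E by exact: chi2_mean_ge0.
have q0 : 0 <= Num.sqrt (l / m) by rewrite sqrtr_ge0.
apply: (@le_trans _ _ ((Num.sqrt (l / m))%:E * chi2_mean l (chi2_mean l I) x)%E).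
  rewrite -chi2_meanZ//; apply: chi2_mean_le => //.
    by apply: emeasurable_funM => //.
  by move=> y; exact: chi2_mean_scale.
rewrite chi2_mean_polar//.
apply: (@le_trans _ _ ((Num.sqrt (l / m))%:E * ((b - a) / (l * 2))%:E)%E).
  apply: lee_wpmul2l; rewrite ?lee_fin//.
  apply: le_trans (integral_itv_sq x l0 ab).
  apply: ge0_le_integral => //.
  - by move=> r; rewrite /= in_itv/= andbT => r0; rewrite mule_ge0// lee_fin mulr_ge0// expR_ge0.
  - apply: measurable_funTS; apply: emeasurable_funM; first exact: measurable_chi2_arg.
    apply/measurable_EFinP; apply: measurable_funM => //.
    apply: measurableT_comp => //; apply: measurable_funM => //.
    by apply: measurable_funN; exact: measurable_funX.
  - apply: measurable_funTS; apply/measurable_EFinP; apply: measurable_funM => //.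
    by apply: measurableT_comp; [exact: measurable_indic|exact: measurable_addsq].
  - move=> r; rewrite /= in_itv/= andbT => r0; rewrite /I -EFinM lee_fin.
    rewrite ler_wpM2l// ler_piMr// -expR0 ler_expR mulr_le0_ge0// oppr_le0 sqr_ge0//.
rewrite -EFinM lee_fin.
have -> : Num.sqrt (l / m) * ((b - a) / (l * 2)) = Num.sqrt (l / m) / (l * 2) * (b - a) by ring.
rewrite ler_wpM2r ?subr_ge0//.
rewrite !sqrtrM ?(ltW l0)// sqrtrV ?(ltW m0)// invfM.
have sl : 0 < Num.sqrt l by rewrite sqrtr_gt0.
have sm : 0 < Num.sqrt m by rewrite sqrtr_gt0.
rewrite -{2}(sqr_sqrtr (ltW l0)) le_eqVlt; apply/orP; left; apply/eqP.
by field; rewrite !gt_eqF.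
Qed.
End Pair.

(** * Trigonometric averages *)

Section Osc.
Variable R : realType.
Local Notation mu := (@lebesgue_measure R).
Local Notation N := (@normal_prob R 0 1).
Implicit Types (c al be t l x r : R).

(** For fixed frequency t and constant c these functions form a class stable
under every average.  The constant keeps them nonnegative, so that they fall
under the theory of averages of nonnegative functions. *)
Definition osc c al be t (y : R) : R := c + al * cos (t * y) + be * sin (t * y).

(** Cauchy-Schwarz for (al, be) and (cos, sin). *)
Lemma osc_norm al be t y r : 0 <= r -> al ^+ 2 + be ^+ 2 <= r ^+ 2 ->
  `|al * cos (t * y) + be * sin (t * y)| <= r.
Proof.
move=> r0 h; rewrite -[leRHS]ger0_norm// -(@ler_pXn2r _ 2) ?nnegrE// !real_normK ?num_real//.
apply: le_trans h; rewrite -subr_ge0.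
have -> : al ^+ 2 + be ^+ 2 - (al * cos (t * y) + be * sin (t * y)) ^+ 2 =
  (al ^+ 2 + be ^+ 2) * (1 - (cos (t * y) ^+ 2 + sin (t * y) ^+ 2)) +
  (al * sin (t * y) - be * cos (t * y)) ^+ 2 by ring.
by rewrite cos2Dsin2 subrr mulr0 add0r sqr_ge0.
Qed.

Lemma osc_ge0 c al be t y : 0 <= c -> al ^+ 2 + be ^+ 2 <= c ^+ 2 ->
  0 <= osc c al be t y.
Proof.
move=> c0 h; rewrite /osc -addrA -lerBlDl sub0r.
by have := osc_norm t y c0 h; rewrite ler_norml => /andP[].
Qed.

Lemma osc_le c al be t y r : 0 <= r -> al ^+ 2 + be ^+ 2 <= r ^+ 2 ->
  osc c al be t y <= c + r.
Proof.
move=> r0 h; rewrite /osc -addrA lerD2l.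
by have := osc_norm t y r0 h; rewrite ler_norml => /andP[].
Qed.

Lemma continuous_osc c al be t : continuous (osc c al be t).
Proof.
move=> y; apply: cvgD.
  apply: cvgD; first exact: cvg_cst.
  apply: cvgM; first exact: cvg_cst.
  apply: (@cvg_comp _ _ _ ( *%R t) (@cos R)); last exact: continuous_cos.
  by apply: cvgM; [exact: cvg_cst|exact: cvg_id].
apply: cvgM; first exact: cvg_cst.
apply: (@cvg_comp _ _ _ ( *%R t) (@sin R)); last exact: continuous_sin.
by apply: cvgM; [exact: cvg_cst|exact: cvg_id].
Qed.

Lemma measurable_osc c al be t : measurable_fun setT (osc c al be t).
Proof. by apply: continuous_measurable_fun; exact: continuous_osc. Qed.

(** Real and imaginary parts of the characteristic function of Z^2. *)
Definition chi2_cos (u : R) : R := \int[N]_z cos (u * z ^+ 2).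
Definition chi2_sin (u : R) : R := \int[N]_z sin (u * z ^+ 2).

Let integrable_trig (h : R -> R) (u : R) : continuous h -> (forall x, `|h x| <= 1) ->
  N.-integrable setT (EFin \o (fun z : R => h (u * z ^+ 2))).
Proof.
move=> ch h1; apply: measurable_bounded_integrable => //.
- by rewrite [ltLHS]probability_setT ltry.
- apply: measurableT_comp; first exact: continuous_measurable_fun.
  by apply: measurable_funM => //; exact: measurable_funX.
- exists 1; split; first exact: num_real.
  by move=> M M1 z _; rewrite /= (le_trans (h1 _))// ltW.
Qed.

(** Multiplication of al - i be by the characteristic function of l Z^2 at t,
in real coordinates. *)
Lemma chi2_mean_osc c al be t l x :
  chi2_mean l (EFin \o osc c al be t) x =
  (osc c (al * chi2_cos (t * l) + be * chi2_sin (t * l))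
         (be * chi2_cos (t * l) - al * chi2_sin (t * l)) t x)%:E.
Proof.
set u := t * l.
have iC := integrable_trig u (@continuous_cos R) (@cos_max R).
have iS := integrable_trig u (@continuous_sin R) (@sin_max R).
pose p := al * cos (t * x) + be * sin (t * x).
pose q := be * cos (t * x) - al * sin (t * x).
pose P (z : R) : R := p * cos (u * z ^+ 2).
pose Q (z : R) : R := q * sin (u * z ^+ 2).
have iP : N.-integrable setT (EFin \o P) by exact: (integrableZl measurableT p iC).
have iQ : N.-integrable setT (EFin \o Q) by exact: (integrableZl measurableT q iS).
have i1 : N.-integrable setT (EFin \o cst c).
  apply: measurable_bounded_integrable => //.
    by rewrite [ltLHS]probability_setT ltry.
  exists `|c|; split; first exact: num_real.
  by move=> M M1 z _; exact: ltW.
have iD : N.-integrable setT (EFin \o (fun z : R => c + P z)).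
  exact: (integrableD measurableT i1 iP).
have iE : N.-integrable setT (EFin \o (fun z : R => c + P z + Q z)).
  exact: (integrableD measurableT iD iQ).
pose g (z : R) : R := c + P z + Q z.
transitivity (\int[N]_z (g z)%:E)%E.
  apply: eq_integral => z _ /=; rewrite /osc /g /P /Q mulrDr mulrA -/u cosD sinD /p /q.
  by congr EFin; ring.
rewrite -[LHS](fineK (integrable_fin_num measurableT iE)).
congr EFin; rewrite -/(Rintegral N setT g) /g RintegralD//= RintegralD// /P /Q.
rewrite RintegralZl// RintegralZl// -/(chi2_cos u) -/(chi2_sin u) Rintegral_cst//.
rewrite [X in fine X]probability_setT mulr1 /osc /p /q; ring.
Qed.

End Osc.

Section Amplitude.
Variable R : realType.
Local Notation mu := (@lebesgue_measure R).
Local Notation N := (@normal_prob R 0 1).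
Implicit Types (c al be t l x r u : R).

(** The primitive is - exp(-r^2/2) (c + P cos(u r^2) + Q sin(u r^2)), where
P - 2 u Q = al and Q + 2 u P = be. *)
Lemma integral_osc_rayleigh c al be u : 0 <= c -> al ^+ 2 + be ^+ 2 <= c ^+ 2 ->
  (\int[mu]_(r in `[0%R, +oo[) (osc c al be u (r ^+ 2) * (r * expR (- r ^+ 2 / 2)))%:E =
   (c + (al + 2 * u * be) / (1 + 4 * u ^+ 2))%:E)%E.
Proof.
move=> c0 h; pose k := 1 + 4 * u ^+ 2.
have k0 : k != 0 by rewrite gt_eqF// ltr_pwDl// mulr_ge0// sqr_ge0.
pose P := (al + 2 * u * be) / k; pose Q := (be - 2 * u * al) / k.
pose F (r : R) := - (expR (- r ^+ 2 / 2) * osc c P Q u (r ^+ 2)).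
have cE : continuous (fun r : R => expR (- r ^+ 2 / 2)).
  move=> r; apply: (@cvg_comp _ _ _ (fun r : R => - r ^+ 2 / 2) (@expR R)); last exact: continuous_expR.
  by apply: cvgM; [apply: cvgN; exact: exprn_continuous|exact: cvg_cst].
have cO a b : continuous (fun r : R => osc c a b u (r ^+ 2)).
  move=> r; apply: (@cvg_comp _ _ _ (fun r : R => r ^+ 2) (osc c a b u)).
    exact: exprn_continuous.
  exact: continuous_osc.
have cF : continuous F by move=> r; apply: cvgN; apply: cvgM; [exact: cE|exact: cO].
have alE : al = P - 2 * u * Q by rewrite /P /Q /k; field.
have beE : be = Q + 2 * u * P by rewrite /P /Q /k; field.
have PQ : P ^+ 2 + Q ^+ 2 <= c ^+ 2.
  have -> : P ^+ 2 + Q ^+ 2 = (al ^+ 2 + be ^+ 2) / k by rewrite /P /Q /k; field.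
  apply: le_trans h; rewrite ler_piMr ?addr_ge0 ?sqr_ge0// invf_le1 ?lt0r ?k0/=.
    by rewrite lerDl mulr_ge0// sqr_ge0.
  by rewrite addr_ge0// mulr_ge0// sqr_ge0.
have Elim : expR (- r ^+ 2 / 2) @[r --> +oo%R] --> (0 : R).
  rewrite (_ : (fun r => _) = (fun v => expR (- v)) \o (fun r : R => 2^-1 * r ^+ 2)); last first.
    by apply/funext => r /=; congr expR; ring.
  apply: cvg_comp; last exact: cvgr_expR.
  by apply: gt0_cvgMry; [rewrite invr_gt0|exact: cvgr_expr2].
have Flim : F x @[x --> +oo%R] --> (0 : R).
  rewrite -oppr0; apply: cvgN.
  apply: (@squeeze_cvgr _ _ _ _ (cst 0) (fun r => expR (- r ^+ 2 / 2) * (c + c))).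
  - near=> r; rewrite mulr_ge0 ?expR_ge0 ?osc_ge0//= ler_wpM2l ?expR_ge0//.
    exact: osc_le.
  - exact: cvg_cst.
  - by rewrite -(mul0r (c + c)); apply: cvgM => //; exact: cvg_cst.
rewrite (@ge0_continuous_FTC2y _ _ F 0 0)//.
- rewrite /F /osc expr0n/= oppr0 mul0r expR0 mulr0 cos0 sin0 mul1r mulr1 mulr0 addr0.
  by rewrite -EFinB sub0r opprK.
- move=> r r0; rewrite !mulr_ge0 ?expR_ge0//; exact: osc_ge0.
- apply: continuous_subspaceT => r; apply: cvgM; first exact: cO.
  by apply: cvgM; [exact: cvg_id|exact: cE].
- by apply: cvg_at_right_filter; exact: cF.
- move=> r _; rewrite derive1E /F /osc derive_val /GRing.scale/= /osc.
  rewrite alE beE; move: P Q (expR _) (cos _) (sin _) {alE beE F cF Flim PQ} => P Q e C S.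
  by field.
Unshelve. all: by end_near. Qed.

(** The sum of two squares is exponential, so its characteristic function at
t l is 1/(1 - 2 i t l); here this is read off at the point 0. *)
Lemma chi2_mean_osc2 c al be t l : 0 <= c -> al ^+ 2 + be ^+ 2 <= c ^+ 2 ->
  chi2_mean l (chi2_mean l (EFin \o osc c al be t)) 0 =
  (c + (al + 2 * (t * l) * be) / (1 + 4 * (t * l) ^+ 2))%:E.
Proof.
move=> c0 h.
rewrite chi2_mean_polar; first last.
- by move=> y /=; rewrite lee_fin osc_ge0.
- by apply/measurable_EFinP; exact: measurable_osc.
rewrite -integral_osc_rayleigh//; apply: eq_integral => r _ /=.
by rewrite -EFinM add0r /osc !mulrA.
Qed.

(** Real and imaginary parts of (E exp(i u Z^2))^2 = 1/(1 - 2 i u). *)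
Lemma chi2_cos_sin (u : R) :
  chi2_cos u ^+ 2 - chi2_sin u ^+ 2 = (1 + 4 * u ^+ 2)^-1 /\
  2 * (chi2_cos u * chi2_sin u) = 2 * u / (1 + 4 * u ^+ 2).
Proof.
have two al be : al ^+ 2 + be ^+ 2 <= 1 ^+ 2 ->
    al * (chi2_cos u ^+ 2 - chi2_sin u ^+ 2) + be * (2 * (chi2_cos u * chi2_sin u)) =
    (al + 2 * u * be) / (1 + 4 * u ^+ 2).
  move=> h; have := @chi2_mean_osc2 1 al be u 1 ler01 h.
  rewrite (_ : chi2_mean 1 (EFin \o _) = EFin \o osc 1 (al * chi2_cos u + be * chi2_sin u)
      (be * chi2_cos u - al * chi2_sin u) u); last first.
    by apply/funext => x; rewrite chi2_mean_osc !mulr1.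
  rewrite chi2_mean_osc /osc !mulr1 !mulr0 cos0 sin0 !mulr1 mulr0 addr0 => -[] /addrI <-.
  ring.
split.
- by have := two 1 0; rewrite mul1r mul0r addr0 mulr0 addr0 mul1r; apply; lra.
- by have := two 0 1; rewrite mul1r mul0r add0r add0r mulr1; apply; lra.
Qed.

(** The squared modulus of the square of a complex number a + i b is
(a^2 - b^2)^2 + (2 a b)^2. *)
Lemma chi2_amplitude (u : R) :
  (chi2_cos u ^+ 2 + chi2_sin u ^+ 2) ^+ 2 = (1 + 4 * u ^+ 2)^-1.
Proof.
have [h1 h2] := chi2_cos_sin u.
have -> : (chi2_cos u ^+ 2 + chi2_sin u ^+ 2) ^+ 2 =
  (chi2_cos u ^+ 2 - chi2_sin u ^+ 2) ^+ 2 + (2 * (chi2_cos u * chi2_sin u)) ^+ 2 by ring.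
rewrite h1 h2; field.
by rewrite gt_eqF// ltr_pwDl// mulr_ge0// sqr_ge0.
Qed.

(** Moduli multiply.  Fourth powers of the amplitude avoid the real
exponent -1/4. *)
Lemma chi2s_mean_osc s c al be t : exists al' be',
  (forall x, chi2s_mean s (EFin \o osc c al be t) x = (osc c al' be' t x)%:E) /\
  (al' ^+ 2 + be' ^+ 2) ^+ 2 * \prod_(l <- s) (1 + 4 * (t * l) ^+ 2) =
  (al ^+ 2 + be ^+ 2) ^+ 2.
Proof.
elim: s => [|l s [al' [be' [IH1 IH2]]]]; first by exists al, be; rewrite big_nil mulr1.
pose C := chi2_cos (t * l); pose S := chi2_sin (t * l).
exists (al' * C + be' * S), (be' * C - al' * S); split=> [x /=|].
  rewrite (_ : chi2s_mean s _ = EFin \o osc c al' be' t); first exact: chi2_mean_osc.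
  by apply/funext => y; exact: IH1.
rewrite big_cons -IH2.
have -> : (al' * C + be' * S) ^+ 2 + (be' * C - al' * S) ^+ 2 =
  (al' ^+ 2 + be' ^+ 2) * (C ^+ 2 + S ^+ 2) by ring.
rewrite exprMn chi2_amplitude; field.
by rewrite gt_eqF// ltr_pwDl// mulr_ge0// sqr_ge0.
Qed.

End Amplitude.

(** * Bounded density when no coefficient dominates *)

Section Smoothing.
Variable R : realType.
Local Notation mu := (@lebesgue_measure R).
Local Notation N := (@normal_prob R 0 1).
Implicit Types (c al be t l x r u v e : R) (s : seq R).

(** Laplace transform of a trigonometric function.  It is used with al = 1 and
be = 0, where it produces the Poisson kernel, and with al = be = 0. *)
Lemma integral_osc_exp c al be v e : 0 < e -> 0 <= c -> al ^+ 2 + be ^+ 2 <= c ^+ 2 ->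
  (\int[mu]_(t in `[0%R, +oo[) (expR (- (e * t)) * osc c al be v t)%:E =
   (c / e + (al * e + be * v) / (e ^+ 2 + v ^+ 2))%:E)%E.
Proof.
move=> e0 c0 h; pose k := e ^+ 2 + v ^+ 2.
have kp : 0 < k by rewrite ltr_pwDl ?sqr_ge0// exprn_gt0.
have k0 : k != 0 by rewrite gt_eqF.
have en0 : e != 0 by rewrite gt_eqF.
pose P := (al * e + be * v) / k; pose Q := (be * e - al * v) / k.
pose F (t : R) := - (expR (- (e * t)) * osc (c / e) P Q v t).
have cE : continuous (fun t : R => expR (- (e * t))).
  move=> t; apply: (@cvg_comp _ _ _ (fun t : R => - (e * t)) (@expR R)); last exact: continuous_expR.
  by apply: cvgN; apply: cvgM; [exact: cvg_cst|exact: cvg_id].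
have cF : continuous F by move=> r; apply: cvgN; apply: cvgM; [exact: cE|exact: continuous_osc].
have alE : al = e * P - v * Q by rewrite /P /Q /k; field.
have beE : be = e * Q + v * P by rewrite /P /Q /k; field.
have ce0 : 0 <= c / e by rewrite divr_ge0// ltW.
have PQ : P ^+ 2 + Q ^+ 2 <= (c / e) ^+ 2.
  have -> : P ^+ 2 + Q ^+ 2 = (al ^+ 2 + be ^+ 2) / k by rewrite /P /Q /k; field.
  rewrite expr_div_n ler_pM ?addr_ge0 ?sqr_ge0 ?invr_ge0 ?(ltW kp)//.
  by rewrite lef_pV2 ?posrE ?exprn_gt0// lerDl sqr_ge0.
have Elim : expR (- (e * t)) @[t --> +oo%R] --> (0 : R).
  apply: (@cvg_comp _ _ _ (fun t : R => e * t) (fun v => expR (- v))); last exact: cvgr_expR.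
  by apply: gt0_cvgMry => //; exact: cvg_id.
have Flim : F x @[x --> +oo%R] --> (0 : R).
  rewrite -oppr0; apply: cvgN.
  apply: (@squeeze_cvgr _ _ _ _ (cst 0) (fun t => expR (- (e * t)) * (c / e + c / e))).
  - near=> r; rewrite mulr_ge0 ?expR_ge0 ?osc_ge0//= ler_wpM2l ?expR_ge0//.
    exact: osc_le.
  - exact: cvg_cst.
  - by rewrite -(mul0r (c / e + c / e)); apply: cvgM => //; exact: cvg_cst.
rewrite (@ge0_continuous_FTC2y _ _ F 0 0)//.
- rewrite /F /osc !mulr0 oppr0 expR0 cos0 sin0 mul1r mulr1 mulr0 addr0.
  by rewrite -EFinB sub0r opprK.
- move=> r r0; rewrite mulr_ge0 ?expR_ge0//; exact: osc_ge0.
- apply: continuous_subspaceT => r; apply: cvgM; first exact: cE.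
  exact: continuous_osc.
- by apply: cvg_at_right_filter; exact: cF.
- move=> r _; rewrite derive1E /F /osc derive_val /GRing.scale/= /osc.
  rewrite alE beE; move: P Q (expR _) (cos _) (sin _) {alE beE F cF Flim PQ} => P Q E C S.
  by field.
Unshelve. all: by end_near. Qed.

Lemma integral_cauchy_scaled (A : R) : 0 < A ->
  (\int[mu]_(t in `[0%R, +oo[) ((1 + A * t ^+ 2)^-1)%:E = (pi / (2 * Num.sqrt A))%:E)%E.
Proof.
move=> A0; have q0 : 0 < Num.sqrt A by rewrite sqrtr_gt0.
have qA : Num.sqrt A ^+ 2 = A by rewrite sqr_sqrtr// ltW.
have kp t : 0 < 1 + A * t ^+ 2 by rewrite ltr_pwDl// mulr_ge0 ?sqr_ge0// ltW.
pose F (t : R) := (Num.sqrt A)^-1 * atan (Num.sqrt A * t).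
have cF : continuous F.
  move=> t; apply: cvgM; first exact: cvg_cst.
  apply: (@cvg_comp _ _ _ ( *%R (Num.sqrt A)) (@atan R)); last exact: continuous_atan.
  by apply: cvgM; [exact: cvg_cst|exact: cvg_id].
rewrite (@ge0_continuous_FTC2y _ _ F 0 ((Num.sqrt A)^-1 * (pi / 2)))//.
- by rewrite /F mulr0 atan0 mulr0 sube0 invfM; congr EFin; ring.
- by move=> t _; rewrite invr_ge0 ltW.
- apply: continuous_subspaceT => t; apply: cvgV; first by rewrite gt_eqF.
  apply: cvgD; first exact: cvg_cst.
  by apply: cvgM; [exact: cvg_cst|exact: exprn_continuous].
- apply: cvgM; first exact: cvg_cst.
  apply: (@cvg_comp _ _ _ ( *%R (Num.sqrt A)) (@atan R)); last exact: cvgy_atan.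
  by apply: gt0_cvgMry => //; exact: cvg_id.
- by apply: cvg_at_right_filter; exact: cF.
- move=> t _; rewrite derive1E /F derive_val /GRing.scale/=.
  have h := kp t; rewrite exprMn qA; move: h q0; move: (Num.sqrt A) (1 + _) => q k k0 q0.
  by field; rewrite !gt_eqF.
Qed.
End Smoothing.

Section Spread.
Variable R : realType.
Local Notation mu := (@lebesgue_measure R).
Local Notation N := (@normal_prob R 0 1).
Implicit Types (c al be t l x y r u v e A : R) (s : seq R).

(** Convexity of exp on the segment from 0 to y, obtained by weighting the
tangent inequality at th y for the two endpoints. *)
Lemma expR_chord (th y : R) : 0 <= th -> th <= 1 ->
  expR (th * y) <= 1 + th * (expR y - 1).
Proof.
move=> th0 th1; set E := expR (th * y).
have E0 : 0 <= E by exact: expR_ge0.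
have h1 : E * (1 + (1 - th) * y) <= expR y.
  rewrite [leRHS](_ : _ = E * expR ((1 - th) * y)).
    by rewrite ler_wpM2l// expR_ge1Dx.
  by rewrite /E -expRD; congr expR; ring.
have h2 : E * (1 - th * y) <= 1.
  rewrite [leRHS](_ : _ = E * expR (- (th * y))).
    by rewrite ler_wpM2l// expR_ge1Dx.
  by rewrite /E expRN divff// gt_eqF// expR_gt0.
have h3 := ler_wpM2l th0 h1.
have th1' : 0 <= 1 - th by rewrite subr_ge0.
have h4 := ler_wpM2l th1' h2.
move: h3 h4; clearbody E => h3 h4.
have := lerD h3 h4; lra.
Qed.

(** Bernoulli's inequality for the exponents 4 l^2/A, which are at most 1 and
sum to 4. *)
Lemma prod_bernoulli s (A t : R) : A = \sum_(l <- s) l ^+ 2 -> 0 < A ->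
  (forall l, l \in s -> 4 * l ^+ 2 <= A) ->
  (1 + A * t ^+ 2) ^+ 4 <= \prod_(l <- s) (1 + 4 * (t * l) ^+ 2).
Proof.
move=> AE A0 hs; set k := 1 + A * t ^+ 2.
have k0 : 0 < k by rewrite ltr_pwDl// mulr_ge0 ?sqr_ge0// ltW.
have -> : k ^+ 4 = expR (\sum_(l <- s) (4 * l ^+ 2 / A) * ln k).
  rewrite -mulr_suml -mulr_suml -mulr_sumr -AE mulfK ?gt_eqF//.
  by rewrite -[4]/(4%:R) expRM_natl lnK.
rewrite expR_sum big_seq [leRHS]big_seq; apply: ler_prod => l ls.
rewrite expR_ge0/= (le_trans (expR_chord _ _ _))//.
- by rewrite divr_ge0 ?(ltW A0)// mulr_ge0 ?sqr_ge0.
- by rewrite ler_pdivrMr// mul1r hs.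
- rewrite lnK ?posrE// /k le_eqVlt; apply/orP; left; apply/eqP.
  by field; rewrite gt_eqF.
Qed.

Let integral_in_indic (D : set R) (F : R * R -> \bar R) :
  (fun y => \int[mu]_(t in D) F (y, t))%E =
  (fun y => \int[mu]_t ((\1_D t)%:E * F (y, t)))%E.
Proof.
apply/funext => y; rewrite integral_mkcond.
by apply: eq_integral => t _; rewrite epatch_indic /= muleC.
Qed.

Let measurable_in_indic (D : set R) (F : R * R -> \bar R) :
  measurable D -> measurable_fun setT F ->
  measurable_fun setT (fun p : R * R => (\1_D p.2)%:E * F p)%E.
Proof.
move=> mD mF; apply: emeasurable_funM => //; apply/measurable_EFinP.
by apply: (@measurableT_comp _ _ _ _ _ _ (\1_D : R -> R) setT snd).
Qed.

Lemma measurable_integral_in (D : set R) (F : R * R -> \bar R) :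
  measurable D -> measurable_fun setT F -> (forall p, (0 <= F p)%E) ->
  measurable_fun setT (fun y => \int[mu]_(t in D) F (y, t))%E.
Proof.
move=> mD mF F0; rewrite integral_in_indic.
apply: (@measurable_fun_fubini_tonelli_F _ _ _ _ _ mu (fun p : R * R => (\1_D p.2)%:E * F p)%E).
  exact: measurable_in_indic.
by move=> p; rewrite mule_ge0// lee_fin.
Qed.

Lemma chi2s_mean_integral_in s (D : set R) (F : R * R -> \bar R) x :
  measurable D -> measurable_fun setT F -> (forall p, (0 <= F p)%E) ->
  chi2s_mean s (fun y => \int[mu]_(t in D) F (y, t))%E x =
  (\int[mu]_(t in D) chi2s_mean s (fun y => F (y, t)) x)%E.
Proof.
move=> mD mF F0; rewrite integral_in_indic.
rewrite (chi2s_mean_integral mu s (F := fun p : R * R => (\1_D p.2)%:E * F p)%E); last 2 first.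
- exact: measurable_in_indic.
- by move=> p; rewrite mule_ge0// lee_fin.
rewrite [RHS]integral_mkcond; apply: eq_integral => t _; rewrite epatch_indic /=.
rewrite chi2s_meanZ//; first by rewrite muleC.
by apply: (measurableT_comp mF); exact: pair2_measurable.
Qed.

Lemma chi2s_mean_cos s A t x y : A = \sum_(l <- s) l ^+ 2 -> 0 < A ->
  (forall l, l \in s -> 4 * l ^+ 2 <= A) ->
  (chi2s_mean s (fun w => (1 + cos (t * (w - y)))%:E) x <=
   (1 + (1 + A * t ^+ 2)^-1)%:E)%E.
Proof.
move=> AE A0 hs.
have k0 : 0 < 1 + A * t ^+ 2 by rewrite ltr_pwDl// mulr_ge0 ?sqr_ge0// ltW.
rewrite (_ : (fun w => _) = EFin \o osc 1 (cos (t * y)) (sin (t * y)) t); last first.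
  apply/funext => w /=; congr EFin; rewrite /osc mulrBr cosD cosN sinN; ring.
have [al [be [-> h]]] := chi2s_mean_osc s 1 (cos (t * y)) (sin (t * y)) t.
rewrite lee_fin; apply: osc_le; first by rewrite invr_ge0 ltW.
move: h; rewrite cos2Dsin2 expr1n => h.
rewrite -(@ler_pXn2r _ 2) ?nnegrE ?addr_ge0 ?sqr_ge0// -exprM -[leLHS]mulr1.
rewrite exprVn -div1r ler_pdivlMr ?exprn_gt0// mulr1 -[leRHS]h ler_wpM2l ?sqr_ge0//.
exact: prod_bernoulli.
Qed.

(** Unnormalised Poisson kernel of the half-plane; its integral is pi. *)
Definition cauchy_kernel (e u : R) : R := e / (e ^+ 2 + u ^+ 2).

Lemma continuous_cauchy_kernel e : 0 < e -> continuous (cauchy_kernel e).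
Proof.
move=> e0 u; apply: cvgM; first exact: cvg_cst.
apply: cvgV; first by rewrite gt_eqF// ltr_pwDl ?sqr_ge0// exprn_gt0.
by apply: cvgD; [exact: cvg_cst|exact: exprn_continuous].
Qed.

Lemma cauchy_kernel_ge0 e u : 0 < e -> 0 <= cauchy_kernel e u.
Proof. by move=> e0; rewrite divr_ge0 ?addr_ge0 ?sqr_ge0// ltW. Qed.

(** The kernel plus the constant 1/e is the integral of
exp(-e t) (1 + cos(t (w - y))), a nonnegative function of (w, t), so Tonelli
applies.  The constant cancels at the end. *)
Lemma chi2s_mean_cauchy s A e x y : A = \sum_(l <- s) l ^+ 2 -> 0 < A ->
  (forall l, l \in s -> 4 * l ^+ 2 <= A) -> 0 < e ->
  (chi2s_mean s (fun w => (cauchy_kernel e (w - y))%:E) x <=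
   (pi / (2 * Num.sqrt A))%:E)%E.
Proof.
move=> AE A0 hs e0.
have mE : measurable_fun setT (fun t : R => expR (- (e * t))).
  apply: measurableT_comp => //; apply: measurable_funN; exact: measurable_funM.
have mcos : measurable_fun setT (@cos R).
  by apply: continuous_measurable_fun; exact: continuous_cos.
have mK : measurable_fun setT (fun w : R => (cauchy_kernel e (w - y))%:E).
  apply/measurable_EFinP; apply: (measurableT_comp (continuous_measurable_fun (continuous_cauchy_kernel e0))).
  exact: measurable_funB.
have K0 w : (0 <= (cauchy_kernel e (w - y))%:E)%E by rewrite lee_fin cauchy_kernel_ge0.
have kp t : 0 < 1 + A * t ^+ 2 by rewrite ltr_pwDl// mulr_ge0 ?sqr_ge0// ltW.
have mrho : measurable_fun setT (fun t : R => ((1 + A * t ^+ 2)^-1)%:E).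
  apply/measurable_EFinP; apply: continuous_measurable_fun => t.
  apply: cvgV; first by rewrite gt_eqF.
  apply: cvgD; first exact: cvg_cst.
  by apply: cvgM; [exact: cvg_cst|exact: exprn_continuous].
have cos1 v : 0 <= 1 + cos v.
  by rewrite -lerBlDl sub0r; have := cos_max v; rewrite ler_norml => /andP[].
have ie0 : 0 <= e^-1 by rewrite invr_ge0 ltW.
rewrite -(@leeD2lE _ (e^-1)%:E)// -EFinD.
rewrite -(chi2s_mean_cst s (e^-1)%:E x) -chi2s_meanD//; last first.
pose F (p : R * R) : \bar R := (expR (- (e * p.2)) * (1 + cos (p.2 * (p.1 - y))))%:E.
have F0 p : (0 <= F p)%E by rewrite lee_fin mulr_ge0 ?expR_ge0.
have mF : measurable_fun setT F.
  apply/measurable_EFinP; apply: measurable_funM.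
    by apply: (measurableT_comp mE); exact: measurable_snd.
  apply: measurable_funD => //; apply: (measurableT_comp mcos).
  apply: measurable_funM; first exact: measurable_snd.
  by apply: measurable_funB.
rewrite (_ : (fun w => _ + _)%E = (fun w => \int[mu]_(t in `[0%R, +oo[) F (w, t))%E); last first.
  apply/funext => w; rewrite /cst -EFinD.
  rewrite -div1r -[cauchy_kernel _ _](_ : (1 * e + 0 * (w - y)) / (e ^+ 2 + (w - y) ^+ 2) = _); last first.
    by rewrite mul1r mul0r addr0.
  rewrite -integral_osc_exp// ?expr1n ?expr0n ?addr0//.
  apply: eq_integral => t _; rewrite /F /osc/= mul1r mul0r addr0.
  by rewrite (mulrC (w - y)).
rewrite chi2s_mean_integral_in//.
apply: (@le_trans _ _ (\int[mu]_(t in `[0%R, +oo[) ((expR (- (e * t)))%:E + ((1 + A * t ^+ 2)^-1)%:E))%E).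
  apply: ge0_le_integral => //.
  - by move=> t _; exact: chi2s_mean_ge0.
  - exact/measurable_funTS/measurable_chi2s_mean_snd.
  - by apply: measurable_funTS; apply: emeasurable_funD; [exact/measurable_EFinP|exact: mrho].
  - move=> t; rewrite /= in_itv/= andbT => t0.
    rewrite (_ : (fun w => F (w, t)) =
      (fun w => (expR (- (e * t)))%:E * (1 + cos (t * (w - y)))%:E)%E)//.
    rewrite chi2s_meanZ ?expR_ge0//; last first.
    + apply/measurable_EFinP; apply: measurable_funD => //; apply: (measurableT_comp mcos).
      by apply: measurable_funM => //; exact: measurable_funB.
    apply: (le_trans (lee_wpmul2l _ (chi2s_mean_cos t x y AE A0 hs))).
      by rewrite lee_fin expR_ge0.
    rewrite -EFinM -EFinD lee_fin mulrDr mulr1 lerD2l ler_piMl ?invr_ge0 ?(ltW (kp t))//.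
    by rewrite -expR0 ler_expR oppr_le0 mulr_ge0// ltW.
rewrite ge0_integralD//; last 3 first.
- by apply: measurable_funTS; exact/measurable_EFinP.
- by move=> t _; rewrite lee_fin invr_ge0 ltW.
- by apply: measurable_funTS; exact: mrho.
rewrite integral_cauchy_scaled// [X in (X + _)%E](_ : _ = (e^-1)%:E)//.
have := @integral_osc_exp R 1 0 0 0 e e0 ler01.
rewrite !mul0r addr0 mul0r addr0 div1r => <-; last by rewrite expr0n/= addr0 expr1n.
by apply: eq_integral => t _; rewrite /osc !mul0r !addr0 mulr1.
Qed.

Lemma integral_cauchy_kernel d e x : 0 < d -> 0 < e ->
  (\int[mu]_(y in `[(x - d)%R, (x + d)%R]) (cauchy_kernel e (x - y)%R)%:E = (2 * atan (d / e))%:E)%E.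
Proof.
move=> d0 e0; pose G (y : R) := atan (e^-1 * (y - x)).
have cG : continuous G.
  move=> y; apply: (@cvg_comp _ _ _ (fun y => e^-1 * (y - x)) (@atan R)); last exact: continuous_atan.
  by apply: cvgM; [exact: cvg_cst|apply: cvgB; [exact: cvg_id|exact: cvg_cst]].
rewrite (@continuous_FTC2 _ _ G)//.
- rewrite /G addrAC subrr add0r [x - d]addrC addrK mulrN atanN -EFinB opprK.
  by congr EFin; rewrite mulrC; ring.
- by rewrite ltrD2l gtrN.
- apply: continuous_subspaceT => y.
  apply: (@cvg_comp _ _ _ (fun y => x - y) (cauchy_kernel e)); last exact: continuous_cauchy_kernel.
  by apply: cvgB; [exact: cvg_cst|exact: cvg_id].
- split=> [y _||].
  + exact: ex_derive.
  + by apply: cvg_at_right_filter; exact: cG.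
  + by apply: cvg_at_left_filter; exact: cG.
- move=> y _; rewrite derive1E /G derive_val /GRing.scale/= /cauchy_kernel.
  have h1 : e ^+ 2 + (x - y) ^+ 2 != 0 by rewrite gt_eqF// ltr_pwDl ?sqr_ge0// exprn_gt0.
  have h2 : 1 + (e^-1 * (y - x)) ^+ 2 != 0 by rewrite gt_eqF// ltr_pwDl ?sqr_ge0.
  have h3 : e != 0 by rewrite gt_eqF.
  rewrite subr0 mulr1 (_ : 1 + _ = (e ^+ 2 + (x - y) ^+ 2) / e ^+ 2); last by field.
  by field; rewrite h3 h1.
Qed.

Definition density_le s (M : R) := forall a b x, a <= b ->
  (chi2s_mean s (fun y => (\1_`[a, b] y)%:E) x <= (M * (b - a))%:E)%E.

(** On [a, b] the convolution of the kernel with the indicator of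
[a - d, b + d] is at least 2 atan(d/e).  Choosing e = d/k, the bound for the
kernel passes to intervals as k tends to infinity and then d to 0. *)
Lemma density_le_spread s (A : R) : A = \sum_(l <- s) l ^+ 2 -> 0 < A ->
  (forall l, l \in s -> 4 * l ^+ 2 <= A) -> density_le s (2 * Num.sqrt A)^-1.
Proof.
move=> AE A0 hs a b x ab.
have q0 : 0 < 2 * Num.sqrt A by rewrite mulr_gt0// sqrtr_gt0.
pose I (y : R) : \bar R := (\1_`[a, b] y)%:E.
have mI : measurable_fun setT I by exact: measurable_EFin_indic_itv.
have I0 y : (0 <= I y)%E by rewrite lee_fin.
have v0 : (0 <= chi2s_mean s I x)%E by exact: chi2s_mean_ge0.
have v1 : (chi2s_mean s I x <= 1)%E.
  rewrite -[leRHS](chi2s_mean_cst s 1%E x); apply: chi2s_mean_le => // y.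
  by rewrite lee_fin indicE; case: (_ \in _).
have vf : chi2s_mean s I x \is a fin_num.
  by rewrite ge0_fin_numE// (le_lt_trans v1)// ltry.
rewrite -/I -(fineK vf) lee_fin; set r := fine _.
have r0 : 0 <= r by exact: fine_ge0.
have claim d k : 0 < d -> 0 < k -> r * (2 * atan k) <= pi / (2 * Num.sqrt A) * (b - a + 2 * d).
  move=> d0 k0; have at0 : 0 < atan k by rewrite -atan0 lt_atan.
  have e0 : 0 < d / k by rewrite divr_gt0.
  have ab' : a - d < b + d by lra.
  pose F (p : R * R) : \bar R := (cauchy_kernel (d / k) (p.1 - p.2))%:E.
  have F0 p : (0 <= F p)%E by rewrite lee_fin cauchy_kernel_ge0.
  have mF : measurable_fun setT F.
    apply/measurable_EFinP; apply: (measurableT_comp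
      (continuous_measurable_fun (continuous_cauchy_kernel e0))).
    by apply: measurable_funB.
  rewrite -lee_fin mulrC EFinM fineK// -chi2s_meanZ//; last by rewrite mulr_ge0// ltW.
  apply: (@le_trans _ _ (chi2s_mean s (fun w => \int[mu]_(y in `[(a - d)%R, (b + d)%R]) F (w, y))%E x)).
    apply: chi2s_mean_le.
    - exact: emeasurable_funM.
    - by apply: measurable_integral_in.
    - by move=> y; rewrite mule_ge0// lee_fin mulr_ge0// ltW.
    - move=> w; rewrite /I indicE; case: (boolP (w \in _)); last first.
        by rewrite mule0 => _; exact: integral_ge0.
      rewrite inE/= in_itv/= mule1 => /andP[aw wb].
      rewrite -[k in atan k](_ : d / (d / k) = k); last by field; rewrite !gt_eqF.
      rewrite -(integral_cauchy_kernel w d0 e0).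
      apply: ge0_subset_integral => //.
      + apply/measurable_EFinP; apply: measurable_funTS.
        apply: (measurableT_comp (continuous_measurable_fun (continuous_cauchy_kernel e0))).
        exact: measurable_funB.
      + by move=> y _; rewrite lee_fin cauchy_kernel_ge0.
      + by move=> y /=; rewrite !in_itv/= => /andP[h1 h2]; apply/andP; split; lra.
  rewrite chi2s_mean_integral_in//.
  apply: (@le_trans _ _ (\int[mu]_(y in `[(a - d)%R, (b + d)%R]) (pi / (2 * Num.sqrt A))%:E)%E).
    apply: ge0_le_integral => //.
    - by move=> y _; exact: chi2s_mean_ge0.
    - exact/measurable_funTS/measurable_chi2s_mean_snd.
    - by move=> y _; exact: (chi2s_mean_cauchy x y AE A0 hs e0).
  rewrite integral_cst//= [X in (_ * X)%E](@lebesgue_measure_itv R `[(a - d)%R, (b + d)%R])/= lte_fin.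
  rewrite ab' -EFinB -EFinM lee_fin.
  by rewrite le_eqVlt; apply/orP; left; apply/eqP; ring.
(* first k -> oo, so that 2 atan k -> pi, then d -> 0 *)
have lim_k d : 0 < d -> r * pi <= pi / (2 * Num.sqrt A) * (b - a + 2 * d).
  move=> d0; set C := (X in _ <= X).
  have cvr : r * (2 * atan k) @[k --> +oo%R] --> r * (2 * (pi / 2)).
    by apply: cvgM; [exact: cvg_cst|apply: cvgM; [exact: cvg_cst|exact: cvgy_atan]].
  rewrite [r * pi](_ : _ = r * (2 * (pi / 2))); last by rewrite mulrC [2 * _]mulrC divfK// mulrC.
  rewrite -(cvg_lim (@Rhausdorff R) cvr); apply: limr_le; first by apply/cvg_ex; exists (r * (2 * (pi / 2))).
  by near=> k; apply: claim => //; near: k; exact: nbhs_pinfty_gt.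
rewrite -(ler_pM2r (@pi_gt0 R)); apply/ler_addgt0Pr => d d0.
have c0 : 0 < pi / (2 * Num.sqrt A) by rewrite divr_gt0// pi_gt0.
have d'0 : 0 < d / (2 * (pi / (2 * Num.sqrt A))) by rewrite divr_gt0// mulr_gt0.
apply: (le_trans (lim_k _ d'0)); rewrite le_eqVlt; apply/orP; left; apply/eqP.
move: c0 q0 {claim lim_k d'0} (@pi_gt0 R); move: (pi : R) => p c0 q0 p0.
have sq : Num.sqrt A != 0 by rewrite gt_eqF// sqrtr_gt0.
by field; rewrite sq gt_eqF.
Unshelve. all: by end_near. Qed.
End Spread.

(** * Three regimes for the upper bound *)

Section Upper.
Variable R : realType.
Local Notation mu := (@lebesgue_measure R).
Local Notation N := (@normal_prob R 0 1).
Local Notation phi := (@normal_pdf R 0 1).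
Implicit Types (l m x y A M : R) (s : seq R).

Lemma density_leW s M M' : M <= M' -> density_le s M -> density_le s M'.
Proof.
move=> MM' h a b x ab; apply: le_trans (h a b x ab) _.
by rewrite lee_fin ler_wpM2r// subr_ge0.
Qed.

(** By commutation the two large coefficients can be averaged first; the
remaining averages preserve a constant bound. *)
Lemma density_le_pair s l m : 0 < m -> m <= l ->
  density_le (l :: m :: s) (2 * Num.sqrt (l * m))^-1.
Proof.
move=> m0 ml a b x ab /=.
have mI := measurable_EFin_indic_itv a b.
set I := (fun y : R => (\1_`[a, b] y)%:E) in mI *.
have I0 y : (0 <= I y)%E by rewrite lee_fin.
have mT k : measurable_fun setT (chi2_mean k I) by exact: measurable_chi2_mean.
have T0 k y : (0 <= chi2_mean k I y)%E by exact: chi2_mean_ge0.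
rewrite (_ : chi2_mean m _ = chi2s_mean s (chi2_mean m I)); last first.
  by apply/funext => y; rewrite chi2_mean_commute.
rewrite -chi2_mean_commute//.
rewrite -[leRHS](chi2s_mean_cst s _ x); apply: chi2s_mean_le => //.
- exact: measurable_chi2_mean.
- by move=> y; exact: chi2_mean_ge0.
- by move=> y; exact: chi2_mean_pair_itv.
Qed.

(** Let u(z) be the probability of the interval given Z = z.  It is at most
M h everywhere, and the integral of z u(z) over z >= 0 is at most h/(2 l).
Splitting at z0 = (2 M l)^(-1/2) balances the two bounds. *)
Lemma density_le_cons s l M : 0 < l -> 0 < M -> density_le s M ->
  density_le (l :: s) (2 * Num.sqrt M / Num.sqrt (pi * l)).
Proof.
move=> l0 M0 hs a b x ab /=.
have mI := measurable_EFin_indic_itv a b.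
set I := (fun y : R => (\1_`[a, b] y)%:E) in mI *.
have I0 y : (0 <= I y)%E by rewrite lee_fin.
pose u (z : R) : \bar R := chi2s_mean s I (x + l * z ^+ 2).
have u0 z : (0 <= u z)%E by exact: chi2s_mean_ge0.
have mu' : measurable_fun setT u.
  by apply: measurable_chi2_arg; exact: measurable_chi2s_mean.
have mphi : measurable_fun setT phi by exact: measurable_normal_pdf.
have ba0 : 0 <= b - a by rewrite subr_ge0.
pose c : R := (Num.sqrt (pi *+ 2))^-1.
have c0 : 0 < c by rewrite /c invr_gt0 sqrtr_gt0 mulrn_wgt0// pi_gt0.
have phic z : phi z <= c.
  rewrite normal_pdf01E -/c ler_piMr ?(ltW c0)// -expR0 ler_expR.
  by rewrite mulr_le0_ge0// oppr_le0 sqr_ge0.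
pose z0 := (Num.sqrt (2 * M * l))^-1.
have Ml0 : 0 < 2 * M * l by rewrite !mulr_gt0.
have z00 : 0 < z0 by rewrite invr_gt0 sqrtr_gt0.
pose D := `[0%R, +oo[%classic : set R.
have mD : measurable D by exact: measurable_itv.
(* exchanging the two integrals leaves an explicit integral over z *)
have tail : (\int[mu]_(z in D) (z%:E * u z) <= ((b - a) / (l * 2))%:E)%E.
  pose F (p : R * R) : \bar R := ((\1_`[a, b] (p.1 + l * p.2 ^+ 2) * `|p.2|)%:E).
  have mF : measurable_fun setT F.
    apply/measurable_EFinP; apply: measurable_funM.
      apply: (@measurableT_comp _ _ _ _ _ _ (\1_`[a, b] : R -> R) setT
        (fun p : R * R => p.1 + l * p.2 ^+ 2)) => //.
      apply: measurable_funD => //; apply: measurable_funM => //.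
      by apply: measurable_funX; exact: measurable_snd.
    by apply: (measurableT_comp (@normr_measurable R setT)); exact: measurable_snd.
  have F0 p : (0 <= F p)%E by rewrite lee_fin mulr_ge0.
  have FE z y : F (y, z) = (`|z|%:E * I (l * z ^+ 2 + y)%R)%E.
    by rewrite /F /I/= -EFinM mulrC addrC.
  rewrite [leLHS](_ : _ = \int[mu]_(z in D) chi2s_mean s (fun y => F (y, z)) x)%E; last first.
    apply: eq_integral => z; rewrite inE /D/= in_itv/= andbT => z_ge0.
    under [in RHS]eq_fun do rewrite FE.
    rewrite chi2s_meanZ//; last by apply: (measurableT_comp mI); exact: measurable_funD.
    by rewrite ger0_norm// chi2s_mean_shift addrC.
  rewrite -chi2s_mean_integral_in//.
  rewrite -[leRHS](chi2s_mean_cst s _ x); apply: chi2s_mean_le => //.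
  - by apply: measurable_integral_in.
  - by move=> y; apply: integral_ge0.
  - move=> y; apply: le_trans (integral_itv_sq y l0 ab).
    rewrite le_eqVlt; apply/orP; left; apply/eqP.
    apply: eq_integral => z; rewrite inE /D/= in_itv/= andbT => z_ge0.
    by rewrite /F/= ger0_norm.
have half : (\int[mu]_(z in D) u z <= (M * (b - a) * z0 + (b - a) / (l * 2) / z0)%:E)%E.
  pose f1 (z : R) : \bar R := ((M * (b - a))%:E * (\1_`[0, z0] z)%:E)%E.
  pose f2 (z : R) : \bar R := ((z0^-1)%:E * (z%:E * u z))%E.
  have Mba : 0 <= M * (b - a) by rewrite mulr_ge0// ltW.
  have m1 : measurable_fun D f1.
    apply: measurable_funTS; apply: emeasurable_funM => //.
    exact: measurable_EFin_indic_itv.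
  have mzu : measurable_fun setT (fun z : R => z%:E * u z)%E by exact: emeasurable_funM.
  have m2 : measurable_fun D f2.
    by apply: measurable_funTS; apply: emeasurable_funM.
  have zu0 z : D z -> (0 <= z%:E * u z)%E.
    by rewrite /D/= in_itv/= andbT => z_ge0; rewrite mule_ge0.
  have z0i : 0 <= z0^-1 by rewrite invr_ge0 ltW.
  have f10 z : D z -> (0 <= f1 z)%E by move=> _; rewrite mule_ge0// lee_fin.
  have f20 z : D z -> (0 <= f2 z)%E by move=> /zu0 ?; rewrite mule_ge0.
  apply: (@le_trans _ _ (\int[mu]_(z in D) (f1 z + f2 z))%E).
    apply: ge0_le_integral => //.
    - exact: measurable_funTS.
    - exact: emeasurable_funD.
    - move=> z; rewrite /D/= in_itv/= andbT => z_ge0; rewrite /f1 /f2 indicE mem_setE in_itv/= z_ge0/=.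
      have [zz0|zz0] := leP z z0.
        rewrite mule1; apply: (@le_trans _ _ (M * (b - a))%:E); first exact: hs.
        by rewrite leeDl// f20// /D/= in_itv/= andbT.
      rewrite mule0 add0e muleA -EFinM -[leLHS]mul1e lee_wpmul2r//.
      by rewrite lee_fin mulrC ler_pdivlMr// mul1r ltW.
  rewrite (ge0_integralD mu mD f10 m1 f20 m2) EFinD; apply: leeD.
    rewrite /f1 ge0_integralZl_EFin//; last first.
      by apply: measurable_funTS; exact: measurable_EFin_indic_itv.
    rewrite integral_indic// [leRHS]EFinM lee_wpmul2l//.
    apply: (@le_trans _ _ (mu `[0%R, z0])); first by apply: le_measure; rewrite ?inE//; exact: measurableI.
    by rewrite lebesgue_measure_itv/= lte_fin z00 sube0.
  rewrite (ge0_integralZl_EFin mu mD zu0 (measurable_funTS mzu) z0i).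
  by rewrite mulrC [leRHS]EFinM; apply: lee_wpmul2l.
rewrite /chi2_mean ge0_integral_normal_prob//.
have muc : measurable_fun setT (fun z => c%:E * u z)%E by exact: emeasurable_funM.
apply: (@le_trans _ _ (\int[mu]_z (c%:E * u z))%E).
  apply: ge0_le_integral => //.
  - by move=> z _; apply: mule_ge0; [exact: u0|rewrite lee_fin normal_pdf_ge0].
  - by apply: emeasurable_funM => //; exact/measurable_EFinP.
  - by move=> z _; rewrite muleC; apply: lee_wpmul2r; [exact: u0|rewrite lee_fin phic].
rewrite ge0_integralZl_EFin//; last exact: ltW.
rewrite ge0_even_integral//; last by move=> z; rewrite /u sqrrN.
apply: (@le_trans _ _ (c%:E * (2%:E * (M * (b - a) * z0 + (b - a) / (l * 2) / z0)%:E))%E).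
  by rewrite lee_wpmul2l ?lee_fin ?(ltW c0)// lee_wpmul2l.
rewrite -!EFinM lee_fin le_eqVlt; apply/orP; left; apply/eqP.
have sM : Num.sqrt M ^+ 2 = M by rewrite sqr_sqrtr// ltW.
have sl : Num.sqrt l ^+ 2 = l by rewrite sqr_sqrtr// ltW.
have s2 : Num.sqrt 2 ^+ 2 = 2 :> R by rewrite sqr_sqrtr.
have M0' : Num.sqrt M != 0 by rewrite gt_eqF// sqrtr_gt0.
have l0' : Num.sqrt l != 0 by rewrite gt_eqF// sqrtr_gt0.
have s20 : Num.sqrt 2 != 0 :> R by rewrite gt_eqF// sqrtr_gt0.
have p0 : Num.sqrt pi != 0 :> R by rewrite gt_eqF// sqrtr_gt0 pi_gt0.
rewrite /c /z0 -[pi *+ 2]mulr_natl !sqrtrM ?pi_ge0 ?mulr_ge0 ?(ltW M0)//.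
move: sM sl s2 M0' l0' s20 p0.
move: (Num.sqrt pi) (Num.sqrt 2) (Num.sqrt M) (Num.sqrt l) => p q m k.
move=> sM sl s2 M0' l0' s20 p0.
rewrite -sM -sl.
have -> : (b - a) / (k ^+ 2 * 2) / (q * m * k)^-1 = (b - a) * m / (q * k).
  by rewrite -[X in k ^+ 2 * X]s2; field; rewrite s20 l0' M0'.
transitivity ((q ^+ 2)^-1 * (4 * m / (p * k) * (b - a))).
  by field; rewrite s20 l0' M0' p0.
by rewrite s2; field; rewrite l0' p0.
Qed.

Lemma sqrt_sqrt_le (x y : R) : 0 <= y -> x <= y ^+ 2 ->
  Num.sqrt (Num.sqrt x) <= Num.sqrt y.
Proof.
by move=> y0 xy; rewrite ler_wsqrtr// -[leRHS]ger0_norm// -sqrtr_sqr ler_wsqrtr.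
Qed.

(** The three cases: no coefficient dominates; the two largest ones dominate;
only the largest one dominates. *)
Lemma density_le_upper (l m : R) s : 0 < m -> m <= l ->
  (forall k, k \in s -> 0 < k <= m) ->
  let A2 := m ^+ 2 + \sum_(k <- s) k ^+ 2 in
  let A1 := l ^+ 2 + A2 in
  density_le [:: l, m & s] (2 / Num.sqrt pi / Num.sqrt (Num.sqrt (A1 * A2))).
Proof.
move=> m0 ml hs A2 A1; have l0 : 0 < l by exact: lt_le_trans ml.
have S0 : 0 <= \sum_(k <- s) k ^+ 2 by apply: sumr_ge0 => k _; exact: sqr_ge0.
have A20 : 0 < A2 by rewrite ltr_pwDl// exprn_gt0.
have A10 : 0 < A1 by rewrite ltr_pwDl// ?exprn_gt0// ltW.
have A21 : A2 <= A1 by rewrite /A1 lerDr sqr_ge0.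
have AA0 : 0 < A1 * A2 by rewrite mulr_gt0.
have q0 : 0 < Num.sqrt (Num.sqrt (A1 * A2)) by rewrite !sqrtr_gt0.
have p0 : 0 < Num.sqrt pi :> R by rewrite sqrtr_gt0 pi_gt0.
have c1 : 1 <= 2 / Num.sqrt pi :> R.
  rewrite ler_pdivlMr// mul1r -[leRHS]ger0_norm// -sqrtr_sqr ler_wsqrtr//.
  by have := @pihalf_lt2 R; lra.
(* the first two cases give (A1 A2)^(-1/4) itself, and 2/sqrt pi >= 1 *)
have enough (y : R) s' : 0 < y -> A1 * A2 <= y ^+ 2 ->
    density_le s' (Num.sqrt y)^-1 ->
    density_le s' (2 / Num.sqrt pi / Num.sqrt (Num.sqrt (A1 * A2))).
  move=> y0 hy; apply: density_leW.
  apply: (@le_trans _ _ (Num.sqrt (Num.sqrt (A1 * A2)))^-1).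
    by rewrite lef_pV2 ?posrE ?sqrtr_gt0// ?sqrt_sqrt_le// ltW.
  by rewrite ler_peMl// invr_ge0 ltW.
have [h1|h1] := leP (4 * l ^+ 2) A1.
  apply: (@enough A1) => //; first by rewrite expr2 ler_wpM2l// ltW.
  apply: (@density_leW _ (2 * Num.sqrt A1)^-1).
    rewrite lef_pV2 ?posrE ?mulr_gt0 ?sqrtr_gt0//.
    by rewrite ler_peMl// ?sqrtr_ge0// ler1n.
  apply: density_le_spread => //; first by rewrite !big_cons.
  move=> k; rewrite !inE => kin; apply: le_trans h1; rewrite ler_wpM2l//.
  suff /andP[k0 kl] : 0 < k <= l by rewrite ler_sqr// nnegrE ltW.
  case/or3P: kin => [/eqP->|/eqP->|/hs/andP[-> /le_trans->]]//; first by rewrite l0 lexx.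
  by rewrite m0.
have [h2|h2] := leP A2 (4 * m ^+ 2).
  apply: (@enough (4 * (l * m))); first by rewrite !mulr_gt0.
    rewrite (_ : (4 * (l * m)) ^+ 2 = (4 * l ^+ 2) * (4 * m ^+ 2)); last by ring.
    by rewrite ler_pM// ltW.
  rewrite sqrtrM// (_ : Num.sqrt 4 = 2); last first.
    by rewrite (_ : 4 = 2 ^+ 2) ?sqrtr_sqr ?ger0_norm//; ring.
  exact: density_le_pair.
have sA0 : 0 < Num.sqrt A2 by rewrite sqrtr_gt0.
have hV : density_le (m :: s) (2 * Num.sqrt A2)^-1.
  apply: density_le_spread => //; first by rewrite big_cons.
  move=> k; rewrite inE => kin; apply: ltW; apply: le_lt_trans h2; rewrite ler_wpM2l//.
  suff /andP[k0 kl] : 0 < k <= m by rewrite ler_sqr// nnegrE ltW.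
  by case/orP: kin => [/eqP->|/hs//]; rewrite m0 lexx.
have M0 : 0 < (2 * Num.sqrt A2)^-1 by rewrite invr_gt0 mulr_gt0.
apply: density_leW (density_le_cons l0 M0 hV).
have y0 : 0 < 2 * Num.sqrt A2 * l by rewrite !mulr_gt0.
have e1 : Num.sqrt (2 * Num.sqrt A2)^-1 = (Num.sqrt (2 * Num.sqrt A2))^-1.
  by rewrite sqrtrV// mulr_ge0// ltW.
have e2 : Num.sqrt (pi * l) = Num.sqrt pi * Num.sqrt l by rewrite sqrtrM// pi_ge0.
rewrite e1 e2 invfM.
rewrite (_ : 2 * (Num.sqrt (2 * Num.sqrt A2))^-1 * ((Num.sqrt pi)^-1 * (Num.sqrt l)^-1)
  = 2 / Num.sqrt pi * (Num.sqrt (2 * Num.sqrt A2 * l))^-1); last first.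
  rewrite [Num.sqrt (_ * l)]sqrtrM ?(mulr_ge0 _ (ltW sA0))// invfM; ring.
rewrite ler_wpM2l ?(le_trans ler01)// lef_pV2 ?posrE ?sqrtr_gt0//.
apply: sqrt_sqrt_le; first exact: ltW.
rewrite !exprMn sqr_sqrtr ?(ltW A20)//.
rewrite (_ : 2 ^+ 2 * A2 * l ^+ 2 = 4 * l ^+ 2 * A2); last by ring.
by rewrite ler_wpM2r ?ltW.
Qed.
End Upper.

(** * Mass near the mean *)

Section Lower.
Variable R : realType.
Local Notation mu := (@lebesgue_measure R).
Local Notation N := (@normal_prob R 0 1).
Local Notation phi := (@normal_pdf R 0 1).
Implicit Types (l m x y v tau : R) (s : seq R).

Let measurable_exp v : measurable_fun setT (fun w : R => (expR (v * w))%:E).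
Proof.
by apply/measurable_EFinP; apply: measurableT_comp => //; exact: measurable_funM.
Qed.

(** Moment generating function of l Z^2: completing the square only rescales
the normal density. *)
Lemma chi2_mean_expR v l x : 2 * (v * l) < 1 ->
  chi2_mean l (fun w => (expR (v * w))%:E) x =
  ((Num.sqrt (1 - 2 * (v * l)))^-1 * expR (v * x))%:E.
Proof.
move=> vl; set k := 1 - 2 * (v * l); have k0 : 0 < k by rewrite subr_gt0.
have q0 : 0 < Num.sqrt k by rewrite sqrtr_gt0.
have mphi : measurable_fun setT (EFin \o phi).
  by apply/measurable_EFinP; exact: measurable_normal_pdf.
have phi0 z : (0 <= (EFin \o phi) z)%E by rewrite lee_fin normal_pdf_ge0.
have e0 w : (0 <= (expR (v * w))%:E)%E by rewrite lee_fin expR_ge0.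
rewrite /chi2_mean (ge0_integral_normal_prob (measurable_chi2_arg l x (measurable_exp v)) (fun z => e0 _)).
have scaled := ge0_integral_scale q0 mphi phi0.
rewrite (_ : (\int[mu]_z (EFin \o phi) z = 1)%E) in scaled; last exact: integral_normal_pdf.
have mphik : measurable_fun setT (fun z => (EFin \o phi) (Num.sqrt k * z)).
  by apply: measurableT_comp => //; exact: measurable_funM.
transitivity ((expR (v * x))%:E * \int[mu]_z ((EFin \o phi) (Num.sqrt k * z)%R))%E.
  rewrite -(ge0_integralZl_EFin mu measurableT (fun z _ => phi0 _) mphik (expR_ge0 _)).
  apply: eq_integral => z _; rewrite /= !normal_pdf01E -!EFinM; congr EFin.
  rewrite mulrCA [RHS]mulrCA; congr (_ * _); rewrite -!expRD exprMn sqr_sqrtr ?ltW//.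
  by congr expR; rewrite /k; field.
rewrite muleC EFinM; congr (_ * _)%E.
transitivity (((Num.sqrt k)^-1)%:E * 1)%E; last by rewrite mule1.
rewrite [X in (_ * X)%E]scaled muleA -EFinM mulVf ?gt_eqF// mul1e.
by []. Qed.

Lemma expR_ge_partial n x : 0 <= x -> \sum_(0 <= i < n) x ^+ i / i`!%:R <= expR x.
Proof.
move=> x0; apply: (@nondecreasing_cvgn_le _ (series (exp_coeff x))).
  by apply/nondecreasing_series => k _ _; exact: exp_coeff_ge0.
exact: is_cvg_series_exp_coeff.
Qed.

(** Equivalent to 1 <= (1 - y) exp(y + y^2).  For y <= 0 the tangent of exp at 0
suffices; for y > 0 the second order Taylor polynomial is needed. *)
Lemma chi2_laplace_bound (y : R) : `|y| <= 2^-1 ->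
  (Num.sqrt (1 - y))^-1 <= expR (2^-1 * (y + y ^+ 2)).
Proof.
rewrite ler_norml => /andP[y1 y2].
have k0 : 0 < 1 - y by lra.
have q0 : 0 < Num.sqrt (1 - y) by rewrite sqrtr_gt0.
rewrite -div1r ler_pdivrMr//.
rewrite -(@ler_pXn2r _ 2) ?nnegrE ?mulr_ge0 ?expR_ge0 ?(ltW q0)//.
rewrite expr1n exprMn sqr_sqrtr ?(ltW k0)// -expRM_natl mulrA mulfV// mul1r.
have [y0|y0] := leP y 0.
  have h := expR_ge1Dx (y + y ^+ 2).
  apply: (@le_trans _ _ ((1 + (y + y ^+ 2)) * (1 - y))); last by rewrite ler_wpM2r// ltW.
  rewrite (_ : _ * _ = 1 - y * y ^+ 2); last by ring.
  by rewrite lerDl oppr_ge0 mulr_le0_ge0// sqr_ge0.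
have u0 : 0 <= y + y ^+ 2 by rewrite addr_ge0 ?sqr_ge0 ?ltW.
set u := y + y ^+ 2 in u0 *.
have h : 1 + u + u ^+ 2 / 2 <= expR u.
  apply: le_trans (expR_ge_partial 3 u0).
  by do 3 rewrite big_nat_recr//; rewrite big_geq//= fact0 ?factS /= !divr1 expr0 expr1 add0r.
apply: (@le_trans _ _ ((1 + u + u ^+ 2 / 2) * (1 - y))); last by rewrite ler_wpM2r// ltW.
rewrite -subr_ge0.
have -> : (1 + u + u ^+ 2 / 2) * (1 - y) - 1 =
  y ^+ 2 * (2^-1 * (1 - y - y ^+ 2 - y ^+ 2 * y)) by rewrite /u; field.
have yy : y ^+ 2 <= 4^-1.
  rewrite (_ : 4^-1 = 2^-1 ^+ 2); last by field.
  by rewrite ler_sqr ?nnegrE ?invr_ge0// ltW.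
have yyy : y ^+ 2 * y <= 4^-1 * 2^-1 by rewrite ler_pM ?sqr_ge0// ltW.
rewrite mulr_ge0 ?sqr_ge0// mulr_ge0 ?invr_ge0//.
move: yy yyy; move: (y ^+ 2) (y ^+ 2 * y) => Y2 Y3 yy yyy; lra.
Qed.

(** Each factor of the moment generating function is compared with that of a
normal variable of the same mean and of twice the variance. *)
Lemma chi2s_mean_expR s v x : (forall l, l \in s -> `|2 * (v * l)| <= 2^-1) ->
  (chi2s_mean s (fun w => (expR (v * w))%:E) x <=
   (expR (v * (x + \sum_(l <- s) l) + 2 * (v ^+ 2 * \sum_(l <- s) l ^+ 2)))%:E)%E.
Proof.
elim: s x => [|l s IH] x hs.
  by rewrite !big_nil /= addr0 !mulr0 addr0.
have hl : `|2 * (v * l)| <= 2^-1 by apply: hs; rewrite mem_head.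
have {IH} hs' y := IH y (fun k ks => hs k (mem_behead (s := l :: s) ks)).
rewrite !big_cons /=; set S1 := \sum_(_ <- _) _ in hs' *; set S2 := \sum_(_ <- _) _ ^+ 2 in hs' *.
pose c := expR (v * S1 + 2 * (v ^+ 2 * S2)).
have c0 : 0 <= c by exact: expR_ge0.
apply: (@le_trans _ _ (chi2_mean l (fun w => c%:E * (expR (v * w))%:E)%E x)).
  apply: chi2_mean_le => //.
  - by apply: measurable_chi2s_mean => // y; rewrite lee_fin expR_ge0.
  - by apply: emeasurable_funM.
  - by move=> y; apply: chi2s_mean_ge0 => z; rewrite lee_fin expR_ge0.
  - move=> y; apply: le_trans (hs' y) _; rewrite -EFinM -expRD lee_fin ler_expR.
    by rewrite le_eqVlt; apply/orP; left; apply/eqP; ring.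
rewrite chi2_meanZ//.
rewrite chi2_mean_expR; last first.
  by move: hl; rewrite ler_norml => /andP[_]; lra.
rewrite -EFinM lee_fin.
apply: (@le_trans _ _ (c * (expR (2^-1 * (2 * (v * l) + (2 * (v * l)) ^+ 2)) * expR (v * x)))).
  by rewrite ler_wpM2l// ler_wpM2r ?expR_ge0// chi2_laplace_bound.
by rewrite /c -!expRD ler_expR le_eqVlt; apply/orP; left; apply/eqP; field.
Qed.

(** Exponential Chebyshev inequality in both directions with exponent
1/(4 tau): the condition on tau keeps 2 v l within 1/2. *)
Lemma chi2s_mean_concentration s tau S : S = \sum_(l <- s) l ->
  0 < tau -> (forall l, l \in s -> 0 < l) ->
  \sum_(l <- s) l ^+ 2 <= tau ^+ 2 ->
  ((1 - 2 * expR (- (15 / 8)))%:E <=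
   chi2s_mean s (fun w => (\1_`[S - 8 * tau, S + 8 * tau] w)%:E) 0)%E.
Proof.
move=> SE t0 spos hA.
have lt l : l \in s -> l <= tau.
  move=> ls; rewrite -ler_sqr ?nnegrE ?(ltW t0) ?(ltW (spos _ ls))//.
  apply: le_trans hA; rewrite (big_rem _ ls)/= lerDl.
  by apply: sumr_ge0 => k _; exact: sqr_ge0.
pose v := (4 * tau)^-1.
have vt : v * (8 * tau) = 2 by rewrite /v; field; rewrite gt_eqF.
have v0 : 0 < v by rewrite invr_gt0 mulr_gt0.
have small (e : R) : `|e| = 1 -> forall l, l \in s -> `|2 * (e * v * l)| <= 2^-1.
  move=> e1 l ls; rewrite !normrM e1 mul1r (gtr0_norm v0) (gtr0_norm (spos _ ls)) ger0_norm//.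
  apply: (@le_trans _ _ (2 * (v * tau))); first by rewrite !ler_pM2l// lt.
  by rewrite le_eqVlt; apply/orP; left; apply/eqP; rewrite /v; field; rewrite gt_eqF.
pose I (w : R) : \bar R := (\1_`[S - 8 * tau, S + 8 * tau] w)%:E.
have mI : measurable_fun setT I by exact: measurable_EFin_indic_itv.
have I0 y : (0 <= I y)%E by rewrite lee_fin.
(* exp(-2) comes from 8 tau v = 2 and exp(1/8) from 2 v^2 tau^2 = 1/8 *)
pose T (e w : R) : \bar R := ((expR (- 2 - e * v * S))%:E * (expR (e * v * w))%:E)%E.
have mT e : measurable_fun setT (T e) by exact: emeasurable_funM.
have T0 e w : (0 <= T e w)%E by rewrite mule_ge0// lee_fin expR_ge0.
have tailE e : `|e| = 1 -> (chi2s_mean s (T e) 0 <= (expR (- (15 / 8)))%:E)%E.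
  move=> e1; rewrite /T chi2s_meanZ ?expR_ge0//.
  apply: (le_trans (lee_wpmul2l _ (chi2s_mean_expR 0 (small e e1)))).
    by rewrite lee_fin expR_ge0.
  rewrite -EFinM -expRD lee_fin ler_expR add0r -SE.
  rewrite (_ : _ + (_ + _) = - 2 + 2 * ((e * v) ^+ 2 * \sum_(l <- s) l ^+ 2)); last by ring.
  rewrite exprMn -[e ^+ 2]real_normK ?num_real// e1 expr1n mul1r.
  have hv : v ^+ 2 * \sum_(l <- s) l ^+ 2 <= v ^+ 2 * tau ^+ 2 by rewrite ler_wpM2l ?sqr_ge0.
  have hv2 : v ^+ 2 * tau ^+ 2 = 1 / 16 by rewrite /v; field; rewrite gt_eqF.
  by move: hv hv2; move: (v ^+ 2 * tau ^+ 2) (v ^+ 2 * _) => p q; lra.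
pose Tp := T 1; pose Tm := T (-1).
have one : (1 <= chi2s_mean s (fun w => I w + (Tp w + Tm w)) 0)%E.
  rewrite -[leLHS](chi2s_mean_cst s 1%E 0); apply: chi2s_mean_le => //.
    by apply: emeasurable_funD => //; apply: emeasurable_funD; exact: mT.
  move=> w; rewrite /I indicE; case: (boolP (w \in _)) => [_|].
    by rewrite leeDl// adde_ge0//; exact: T0.
  rewrite notin_setE/= in_itv/= => /negP; rewrite negb_and -!ltNge add0e => /orP hw.
  have expge (z : R) : 0 <= z -> (1 <= (expR z)%:E)%E.
    by move=> z0; rewrite lee_fin -expR0 ler_expR.
  case: hw => hw.
    apply: (@le_trans _ _ (Tm w)); last by rewrite leeDr//; exact: T0.
    rewrite /Tp /Tm /T -EFinM -expRD; apply: expge.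
    have : v * (S - w) >= v * (8 * tau) by rewrite ler_pM2l//; lra.
    by rewrite vt => h; apply: le_trans (_ : - 2 + v * (S - w) <= _);
      [lra|rewrite le_eqVlt; apply/orP; left; apply/eqP; ring].
  apply: (@le_trans _ _ (Tp w)); last by rewrite leeDl//; exact: T0.
  rewrite /Tp /Tm /T -EFinM -expRD; apply: expge.
  have : v * (w - S) >= v * (8 * tau) by rewrite ler_pM2l//; lra.
  by rewrite vt => h; apply: le_trans (_ : - 2 + v * (w - S) <= _);
      [lra|rewrite le_eqVlt; apply/orP; left; apply/eqP; ring].
move: one; rewrite chi2s_meanD//; last 2 first.
- by apply: emeasurable_funD; exact: mT.
- by move=> y; rewrite adde_ge0//; exact: T0.
rewrite chi2s_meanD//; try exact: mT; try exact: T0; move=> one.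
rewrite EFinB leeBlDr// (le_trans one)// leeD2l//.
rewrite (_ : 2 * _ = expR (- (15 / 8)) + expR (- (15 / 8))); last by ring.
by rewrite EFinD leeD// tailE// ?normr1 ?normrN1.
Qed.
End Lower.

Section NearMean.
Variable R : realType.
Local Notation mu := (@lebesgue_measure R).
Local Notation N := (@normal_prob R 0 1).
Local Notation phi := (@normal_pdf R 0 1).
Implicit Types (l m x y v tau r : R) (s : seq R).

(** With a = exp(1/8) this is 17 <= 8 (a^12 - 2 a^(-3)), and a >= 9/8 is
enough. *)
Lemma lower_numeric :
  17 / (4 * expR 1 ^+ 2) <= 2 * (1 - 2 * expR (- (15 / 8))) * expR (- 1 ^+ 2 / 2) :> R.
Proof.
pose a : R := expR (8^-1).
have a1 : 1 + 8^-1 <= a by exact: expR_ge1Dx.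
have a0 : 0 < a by exact: expR_gt0.
have e1 : expR 1 = a ^+ 8 by rewrite /a -expRM_natl mulfV.
have e2 : expR (- (15 / 8)) = (a ^+ 15)^-1.
  by rewrite /a -expRM_natl -expRN; congr expR; field.
have e3 : expR (- 1 ^+ 2 / 2) = (a ^+ 4)^-1.
  by rewrite /a -expRM_natl -expRN; congr expR; field.
rewrite e1 e2 e3.
have b15 : (9 / 8) ^+ 15 <= a ^+ 15 by rewrite ler_pXn2r ?nnegrE ?(ltW a0)//; lra.
have b12 : (9 / 8) ^+ 12 <= a ^+ 12 by rewrite ler_pXn2r ?nnegrE ?(ltW a0)//; lra.
have c15 : (a ^+ 15)^-1 <= 6 / 35.
  have h : 35 / 6 <= a ^+ 15 by apply: le_trans b15; lra.
  by rewrite (_ : 6 / 35 = (35 / 6)^-1) ?lef_pV2 ?posrE ?exprn_gt0//; field.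
have c12 : 41 / 10 <= a ^+ 12 by apply: le_trans b12; lra.
have : 17 <= 8 * (1 - 2 * (a ^+ 15)^-1) * a ^+ 12.
  have h : 23 / 35 <= 1 - 2 * (a ^+ 15)^-1 by lra.
  apply: (@le_trans _ _ (8 * (23 / 35) * (41 / 10))); first by lra.
  by rewrite ler_pM ?ler_pM2l//; lra.
move=> h; rewrite ler_pdivrMr ?mulr_gt0 ?exprn_gt0//; apply: le_trans h _.
rewrite le_eqVlt; apply/orP; left; apply/eqP.
by move: (_ ^-1) => u; field; rewrite gt_eqF.
Qed.

(** With d = r tau, the event |Z| <= d forces l Z^2 <= tau, and it has
probability at least 2 d exp(-1/2)/sqrt(2 pi) because d <= 1.  The parameter r
stands for min(1, sqrt(tau/l))/tau up to a factor at most 1. *)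
Lemma mass_lower l s S tau r : S = \sum_(k <- s) k -> 0 < l -> 0 < tau ->
  (forall k, k \in s -> 0 < k) -> \sum_(k <- s) k ^+ 2 <= tau ^+ 2 ->
  0 <= r -> r * tau <= 1 -> r ^+ 2 * (tau * l) <= 1 ->
  ((1 / (4 * expR 1 ^+ 2 * Num.sqrt (2 * pi)) * r * (17 * tau))%:E <=
   chi2s_mean (l :: s) (fun w => (\1_`[S - 8 * tau, S + 9 * tau] w)%:E) 0)%E.
Proof.
move=> SE l0 t0 spos hA r0 rt rl /=.
set J := (fun w : R => (\1_`[S - 8 * tau, S + 9 * tau] w)%:E).
have mJ : measurable_fun setT J by exact: measurable_EFin_indic_itv.
have J0 y : (0 <= J y)%E by rewrite lee_fin.
pose q : R := 1 - 2 * expR (- (15 / 8)).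
have near0 x : 0 <= x -> x <= tau -> (q%:E <= chi2s_mean s J x)%E.
  move=> x0 xt; apply: (le_trans (chi2s_mean_concentration SE t0 spos hA)).
  rewrite -[x in leRHS]addr0 -chi2s_mean_shift; apply: chi2s_mean_le => //.
  - exact: measurable_EFin_indic_itv.
  - by apply: (measurableT_comp mJ); exact: measurable_funD.
  - move=> w; rewrite /J lee_fin !indicE !mem_setE !in_itv/=.
    case: (boolP (_ && _)) => [/andP[h1 h2]|_]; last by rewrite ler0n.
    by rewrite (_ : _ && _ = true)//; apply/andP; split; lra.
pose c : R := (Num.sqrt (pi *+ 2))^-1.
have c0 : 0 < c by rewrite /c invr_gt0 sqrtr_gt0 mulrn_wgt0// pi_gt0.
have numeric := lower_numeric.
have q0 : 0 <= q.
  move: numeric; rewrite -/q => h.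
  have : 0 <= 2 * q * expR (- 1 ^+ 2 / 2).
    by apply: le_trans h; rewrite divr_ge0// mulr_ge0// sqr_ge0.
  by rewrite pmulr_lge0 ?expR_gt0// pmulr_rge0.
pose d := r * tau; have d0 : 0 <= d by rewrite mulr_ge0// ltW.
have ld z : `|z| <= d -> l * z ^+ 2 <= tau.
  move=> zd; apply: (@le_trans _ _ (l * d ^+ 2)).
    by rewrite ler_pM2l// -[z ^+ 2]real_normK ?num_real// ler_sqr.
  rewrite (_ : l * d ^+ 2 = r ^+ 2 * (tau * l) * tau); last by rewrite /d; ring.
  by rewrite ler_piMl// ltW.
pose D := `[- d, d]%classic : set R.
have mD : measurable D by exact: measurable_itv.
have normalD : ((c * expR (- 1 ^+ 2 / 2) * (2 * d))%:E <= N D)%E.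
  apply: (@le_trans _ _ (\int[mu]_(z in D) (c * expR (- 1 ^+ 2 / 2))%:E)%E).
    rewrite integral_cst//= [X in (_ * X)%E]lebesgue_measure_itv/= lte_fin.
    case: ltP => hd; first by rewrite -EFinD -EFinM lee_fin (_ : d - - d = 2 * d)//; ring.
    by rewrite mule0 lee_fin mulr_ge0_le0 ?mulr_ge0 ?expR_ge0 ?(ltW c0)//; lra.
  apply: ge0_le_integral => //.
  - by move=> z _; rewrite lee_fin mulr_ge0 ?expR_ge0 ?(ltW c0).
  - by apply/measurable_EFinP; apply: measurable_funTS; exact: measurable_normal_pdf.
  - move=> z; rewrite /D/= in_itv/= -ler_norml => zd.
    rewrite lee_fin normal_pdf01E -/c ler_pM2l// ler_expR ler_pM2r ?invr_gt0// lerN2.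
    by rewrite -[z ^+ 2]real_normK ?num_real// ler_sqr ?nnegrE// (le_trans zd).
apply: (@le_trans _ _ (q%:E * N D)%E).
  apply: (le_trans _ (lee_wpmul2l _ normalD)); last by rewrite lee_fin.
  rewrite -EFinM lee_fin.
  have -> : 1 / (4 * expR 1 ^+ 2 * Num.sqrt (2 * pi)) * r * (17 * tau) =
      (17 / (4 * expR 1 ^+ 2)) * (c * d).
    rewrite /c /d [2 * pi]mulr_natl.
    have : Num.sqrt (pi *+ 2) != 0 :> R by rewrite gt_eqF// sqrtr_gt0 mulrn_wgt0// pi_gt0.
    have : expR 1 != 0 :> R by rewrite gt_eqF// expR_gt0.
    by move: (Num.sqrt _) (expR 1) => p e p0 e0; field; rewrite p0 e0.
  rewrite (_ : q * _ = 2 * q * expR (- 1 ^+ 2 / 2) * (c * d)); last by ring.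
  by rewrite ler_wpM2r// mulr_ge0// ltW.
have -> : N D = (\int[N]_z (\1_D z)%:E)%E by rewrite integral_indic// setIT.
rewrite /chi2_mean.
rewrite -ge0_integralZl_EFin//; last first.
  by apply/measurable_EFinP; exact: measurable_indic.
apply: ge0_le_integral => //.
- by move=> z _; rewrite mule_ge0// lee_fin.
- by apply: emeasurable_funM => //; apply/measurable_EFinP; exact: measurable_indic.
- by apply: measurable_chi2_arg; exact: measurable_chi2s_mean.
- move=> z _; rewrite indicE; case: (boolP (z \in D)) => [|_].
    rewrite inE /D/= in_itv/= -ler_norml mule1 => zd.
    by apply: near0; rewrite add0r; [rewrite mulr_ge0 ?sqr_ge0// ltW|exact: ld].
  by rewrite mule0; exact: chi2s_mean_ge0.
Qed.
End NearMean.

(** * Numerical values *)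

Section Numerics.
Variable R : realType.

(** The terms of the cosine series decrease in modulus, as x^2 <= 4 < 12. *)
Lemma cos_coeff_pair (x : R) k : 0 < x -> x <= 2 -> (0 < k)%N ->
  0 < (-1) ^+ k * (cos_coeff' x k + cos_coeff' x k.+1).
Proof.
move=> x0 x2 k0; rewrite /cos_coeff' -!exprnP.
pose y : R := x ^+ k.*2 / k.*2`!%:R.
have y0 : 0 < y by rewrite divr_gt0 ?exprn_gt0// ltr0n fact_gt0.
pose m : R := k.*2.+1%:R * k.*2.+2%:R.
have m12 : 12 <= m.
  have k2 : (2 <= k.*2)%N by have := leq_double 1 k; rewrite k0.
  rewrite (_ : 12 = 3%:R * 4%:R :> R); last by rewrite -natrM.
  by rewrite ler_pM ?ler0n ?ler_nat.
have m0 : 0 < m by apply: lt_le_trans m12.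
have E2 : (-1) ^+ k.+1 * x ^+ k.+1.*2 / k.+1.*2`!%:R = - ((-1) ^+ k * (y * (x ^+ 2 / m))) :> R.
  rewrite doubleS !factS !natrM /y /m exprS mulN1r (exprD x 2 k.*2) !mulNr; congr (- _).
  have f0 : k.*2`!%:R != 0 :> R by rewrite pnatr_eq0 -lt0n fact_gt0.
  have p0 : k.*2.+1%:R != 0 :> R by rewrite pnatr_eq0.
  have q0 : k.*2.+2%:R != 0 :> R by rewrite pnatr_eq0.
  move: f0 p0 q0; move: (k.*2`!%:R) (k.*2.+1%:R) (k.*2.+2%:R) => f p q f0 p0 q0.
  by field; rewrite f0 p0 q0.
have E1 : (-1) ^+ k * x ^+ k.*2 / k.*2`!%:R = (-1) ^+ k * y by rewrite /y mulrA.
rewrite E1 E2 -mulrBr [X in 0 < X]mulrA -expr2 sqrr_sign mul1r.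
rewrite (_ : _ - _ = y * (1 - x ^+ 2 / m)); last by rewrite mulrBr mulr1.
rewrite mulr_gt0// subr_gt0 ltr_pdivrMr// mul1r.
apply: lt_le_trans m12; apply: (@le_lt_trans _ _ (2 ^+ 2)); last by lra.
by rewrite ler_sqr ?nnegrE// ltW.
Qed.

Let sign_double d : (-1) ^+ d.*2 = 1 :> R.
Proof. by rewrite -signr_odd odd_double. Qed.

Lemma cos_gt_taylor6 (x : R) : 0 < x -> x <= 2 ->
  1 - x ^+ 2 / 2 + x ^+ 4 / 24 - x ^+ 6 / 720 < cos x.
Proof.
move=> x0 x2; have h := @cvg_cos_coeff' R x; rewrite -(cvg_lim (@Rhausdorff R) h).
apply: (@le_lt_trans _ _ (\sum_(0 <= i < 4) cos_coeff' x i)); last first.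
  apply: lt_sum_lim_series; first by move/cvgP : h.
  move=> d; have := @cos_coeff_pair x (4 + d.*2) x0 x2 isT.
  by rewrite exprD sign_double mulr1 -signr_odd/= expr0 mul1r !addnS.
do 4 rewrite big_nat_recr//; rewrite big_geq//= add0r /cos_coeff' -!exprnP.
by rewrite !factS fact0 /= !exprS expr0; lra.
Qed.

Lemma cos_lt_taylor4 (x : R) : 0 < x -> x <= 2 ->
  cos x < 1 - x ^+ 2 / 2 + x ^+ 4 / 24.
Proof.
move=> x0 x2; rewrite -[ltLHS]opprK ltrNl.
have h0 := @cvg_cos_coeff' R x; have /cvgN h := h0.
rewrite -(cvg_lim (@Rhausdorff R) h).
apply: (@le_lt_trans _ _ (\sum_(0 <= i < 3) - cos_coeff' x i)); last first.
  rewrite -seriesN; apply: lt_sum_lim_series; first by move/cvgP in h; rewrite seriesN.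
  move=> d; have := @cos_coeff_pair x (3 + d.*2) x0 x2 isT.
  by rewrite exprD sign_double mulr1 -signr_odd/= expr1 mulN1r opprD !addnS.
do 3 rewrite big_nat_recr//; rewrite big_geq//= add0r /cos_coeff' -!exprnP.
by rewrite !factS fact0 /= !exprS expr0; lra.
Qed.

(** The constant 113/36 exceeds (2000/1129)^2, which is what 2/sqrt pi < 1.129
requires. *)
Lemma pi_gt : 113 / 36 < pi :> R.
Proof.
have c0 : 0 < cos (113 / 72 : R).
  by apply: le_lt_trans (cos_gt_taylor6 _ _); rewrite ?exprS ?expr0; lra.
have p0 := @pi_gt0 R.
rewrite (_ : 113 / 36 = 2 * (113 / 72)); last by lra.
rewrite mulrC -ltr_pdivlMr//.
rewrite -ltr_cos ?cos_pihalf// in_itv/=; last by lra.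
have := @pi_ge2 R; lra.
Qed.

Lemma pi_lt : pi < 32 / 10 :> R.
Proof.
have c0 : cos (16 / 10 : R) < 0.
  by apply: lt_le_trans (cos_lt_taylor4 _ _) _; rewrite ?exprS ?expr0; lra.
have p0 := @pi_gt0 R; have p2 := @pi_ge2 R.
rewrite (_ : 32 / 10 = 16 / 10 * 2); last by lra.
rewrite -ltr_pdivrMr// -ltr_cos ?cos_pihalf// in_itv/=; lra.
Qed.

(** From exp(1/64) <= 64/63 by squaring six times with rounding upwards. *)
Lemma expR1_ub : expR 1 < 2756 / 1000 :> R.
Proof.
pose a : R := expR (64^-1).
have a0 : 0 <= a by exact: expR_ge0.
have h0 : a <= 64 / 63.
  have : 1 + (- 64^-1) <= expR (- 64^-1) :> R by exact: expR_ge1Dx.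
  rewrite expRN -/a => h.
  have := ler_wpM2r a0 h; rewrite mulVf; last by rewrite gt_eqF// expR_gt0.
  lra.
have sq (u v w : R) : 0 <= u -> u <= v -> v * v <= w -> 0 <= u ^+ 2 /\ u ^+ 2 <= w.
  move=> u0 uv vw; rewrite sqr_ge0; split=> //; apply: le_trans vw.
  by rewrite expr2 ler_pM.
have [a1 h1] := @sq _ _ (1032 / 1000) a0 h0 ltac:(clear; lra).
have [a2 h2] := @sq _ _ (4261 / 4000) a1 h1 ltac:(clear; lra).
have [a3 h3] := @sq _ _ (1135 / 1000) a2 h2 ltac:(clear; lra).
have [a4 h4] := @sq _ _ (143 / 111) a3 h3 ltac:(clear; lra).
have [a5 h5] := @sq _ _ (83 / 50) a4 h4 ltac:(clear; lra).
have [a6 h6] := @sq _ _ ((83 / 50) * (83 / 50)) a5 h5 ltac:(clear; lra).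
have -> : expR 1 = a ^+ 2 ^+ 2 ^+ 2 ^+ 2 ^+ 2 ^+ 2 :> R.
  by rewrite -!exprM /a -expRM_natl mulfV// pnatr_eq0.
apply: le_lt_trans h6 _; clear; lra.
Qed.

Lemma c0_gt : 13 / 1000 < 1 / (4 * expR 1 ^+ 2 * Num.sqrt (2 * pi)) :> R.
Proof.
have e0 : 0 < expR 1 :> R by exact: expR_gt0.
have p0 := @pi_gt0 R.
have s0 : 0 < Num.sqrt (2 * pi) :> R by rewrite sqrtr_gt0 mulr_gt0.
have sb : Num.sqrt (2 * pi) <= 253 / 100 :> R.
  rewrite -[leRHS]ger0_norm -?sqrtr_sqr; last by lra.
  by rewrite ler_wsqrtr//; have := pi_lt; lra.
have eb : expR 1 ^+ 2 <= (2756 / 1000) ^+ 2 :> R.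
  have b0 : 0 <= 2756 / 1000 :> R by clear; lra.
  by rewrite ler_sqr ?nnegrE ?(ltW e0)// ltW// expR1_ub.
have num : 13 / 1000 * (4 * (2756 / 1000) ^+ 2 * (253 / 100)) < 1 :> R.
  by clear; rewrite expr2; lra.
have den0 : 0 < 4 * expR 1 ^+ 2 * Num.sqrt (2 * pi) :> R.
  by apply: mulr_gt0 => //; apply: mulr_gt0 => //; exact: exprn_gt0.
rewrite (ltr_pdivlMr _ _ den0); apply: (le_lt_trans _ num).
apply: ler_wpM2l; first by clear; lra.
apply: ler_pM; [by apply: mulr_ge0 => //; exact: sqr_ge0|exact: ltW| |exact: sb].
exact: ler_wpM2l.
Qed.

Lemma c1_lt : 2 / Num.sqrt pi < 1129 / 1000 :> R.
Proof.
have p0 := @pi_gt0 R; have s0 : 0 < Num.sqrt pi :> R by rewrite sqrtr_gt0.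
rewrite (ltr_pdivrMr _ _ s0).
have b0 : 0 <= 2000 / 1129 :> R by clear; lra.
have bpi : (2000 / 1129) ^+ 2 < pi :> R.
  by apply: lt_trans pi_gt; rewrite expr2; clear; lra.
have h : 2000 / 1129 < Num.sqrt pi :> R.
  by rewrite -[ltLHS](ger0_norm b0) -sqrtr_sqr ltr_sqrt.
by move: (Num.sqrt pi) h; clear => q h; lra.
Qed.
End Numerics.

(** * From independent variables to iterated averages *)

Section Transfer.
Variables (R : realType) (d : measure_display) (T : measurableType d).
Variables (P : probability T R) (n : nat) (Z : 'I_n -> {RV P >-> R}).
Variable lambda : 'I_n -> R.
Local Notation N := (@normal_prob R 0 1).

Let W (k : nat) (t : T) : R := \sum_(i < n | (i < k)%N) lambda i * Z i t ^+ 2.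

Let measurable_W k : measurable_fun setT (W k).
Proof.
rewrite /W; under eq_fun do rewrite big_mkcond /=.
apply: (@measurable_sum _ _ _ _ _ _ (fun (i : 'I_n) t =>
  if (i < k)%N then lambda i * Z i t ^+ 2 else 0)) => i.
have [_|_] := boolP (i < k)%N; last exact: measurable_cst.
by apply: measurable_funM => //; apply: measurable_funX.
Qed.

HB.instance Definition _ k := isMeasurableFun.Build _ _ _ _ (W k) (measurable_W k).

Let W_succ k (hk : (k < n)%N) t :
  W k.+1 t = W k t + lambda (Ordinal hk) * Z (Ordinal hk) t ^+ 2.
Proof.
rewrite /W (bigD1 (Ordinal hk))/= ?ltnSn// addrC; congr (_ + _).
apply: eq_bigl => i; rewrite ltnS [in RHS]ltn_neqAle andbC; congr (_ && _).
Qed.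

Let D k (B : 'I_n -> set R) : set T := [set t | forall j : 'I_n, (k <= j)%N -> B j (Z j t)].

Let measurable_D k B : (forall j, measurable (B j)) -> measurable (D k B).
Proof.
move=> mB; rewrite (_ : D k B = \bigcap_(j in [set j : 'I_n | (k <= j)%N]) (Z j @^-1` B j)).
  apply: fin_bigcap_measurable => [|j _]; first exact: finite_finset.
  by rewrite -[_ @^-1` _]setTI; exact: measurable_funP.
by apply/seteqP; split => t h j; exact: h.
Qed.

(** Independence of the k-th partial sum from the family of the later
variables. *)
Let Split k := forall (A : set R) B, measurable A -> (forall j, measurable (B j)) ->
  P (W k @^-1` A `&` D k B) =
  (P (W k @^-1` A) * \prod_(j < n | (k <= j)%N) P (Z j @^-1` B j))%E.

Let prod_fin k (B : 'I_n -> set R) : (forall j, measurable (B j)) ->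
  (\prod_(j < n | (k <= j)%N) P (Z j @^-1` B j))%E \is a fin_num.
Proof.
move=> mB; apply: (big_ind (fun x : \bar R => x \is a fin_num)) => //.
  by move=> x y; exact: fin_numM.
move=> j _; apply: fin_num_measure.
by rewrite -[_ @^-1` _]setTI; exact: measurable_funP.
Qed.

(** Both sides are finite measures of C that agree on rectangles.  Keeping the
events of the later variables inside the statement makes the induction work. *)
Let pair_split k (hk : (k < n)%N) B (C : set (R * R)) : Split k ->
  (forall j, measurable (B j)) -> measurable C ->
  P ([set t | C (W k t, Z (Ordinal hk) t)] `&` D k.+1 B) =
  ((distribution P (W k) \x distribution P (Z (Ordinal hk)))%E C *
   \prod_(j < n | (k < j)%N) P (Z j @^-1` B j))%E.
Proof.
move=> Sk mB mC; set o := Ordinal hk.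
have pf := prod_fin k.+1 mB; set pr := (\prod_(j < n | _) _)%E in pf *.
have pr0 : (0 <= pr)%E by apply: prode_ge0.
pose c : {nonneg R} := NngNum (fine_ge0 pr0).
have cE : (c%:num)%:E = pr by rewrite /= fineK.
have mD := measurable_D k.+1 mB.
have mpair : measurable_fun setT (fun t => (W k t, Z o t)).
  by apply/measurable_fun_pairP; split => //=.
pose m2 := distribution P (Z o); pose m1 := distribution P (W k).
have rect A B0 : measurable A -> measurable B0 ->
    pushforward (mrestr P mD) (fun t => (W k t, Z o t)) (A `*` B0) = (m1 A * mscale c m2 B0)%E.
  move=> mA mB0; pose B' j := if j == o then B0 else B j.
  have mB' j : measurable (B' j) by rewrite /B'; case: ifP.
  have setE : [set t | (A `*` B0) (W k t, Z o t)] `&` D k.+1 B = W k @^-1` A `&` D k B'.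
    apply/seteqP; split => t [] /=.
      move=> [At Bt] h; split => // j kj; rewrite /B'; case: eqP => [->//|/eqP jo].
      by apply: h; rewrite ltn_neqAle kj andbT; apply: contra_neq jo => e; exact/val_inj.
    move=> At h; split; first by split => //; have := h o (leqnn _); rewrite /B' eqxx.
    move=> j kj; have := h j (ltnW kj); rewrite /B'; case: eqP => // e.
    by move: kj; rewrite e ltnn.
  rewrite /pushforward /mrestr [X in P X]setE Sk// /m1 /distribution /pushforward; congr (_ * _)%E.
  rewrite (bigD1 o)/=; last by rewrite leqnn.
  rewrite {1}/B' eqxx /mscale cE muleC; congr (_ * _)%E.
  apply: eq_big => [j|j]; first by rewrite [in RHS]ltn_neqAle andbC eq_sym.
  by rewrite /B' => /andP[_ /negbTE->].
have := @product_measure_unique _ _ _ _ _ m1 (mscale c m2) _ rect C mC.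
move=> /(_ mpair) E; transitivity ((m1 \x mscale c m2)%E C); first exact: (esym E).
rewrite muleC -cE /product_measure1 -ge0_integralZl_EFin//.
exact: measurable_fun_xsection.
Qed.

Let split_succ k : (k < n)%N -> Split k -> Split k.+1.
Proof.
move=> hk Sk A B mA mB; pose o := Ordinal hk.
pose C : set (R * R) := [set p | A (p.1 + lambda o * p.2 ^+ 2)].
have mC : measurable C.
  rewrite -[C]setTI; apply: (_ : measurable_fun setT (fun p : R * R => p.1 + lambda o * p.2 ^+ 2)) => //.
  apply: measurable_funD => //; apply: measurable_funM => //.
  by apply: measurable_funX; exact: measurable_snd.
have WC : W k.+1 @^-1` A = [set t | C (W k t, Z o t)].
  by apply/seteqP; split => t /=; rewrite /C/= W_succ.
rewrite [in LHS]WC (pair_split hk Sk mB mC); congr (_ * _)%E.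
have := @pair_split k hk (fun=> setT) C Sk (fun=> measurableT) mC.
rewrite (_ : D k.+1 _ = setT); last by apply/seteqP; split.
rewrite setIT -WC => ->; rewrite big1 ?mule1// => j _.
by rewrite preimage_setT probability_setT.
Qed.

Hypothesis hind : mutually_independent Z.

Let split_all k : (k <= n)%N -> Split k.
Proof.
elim: k => [_|k IH hk]; last by apply: split_succ => //; exact/IH/ltnW.
move=> A B mA mB.
have D0 : D 0 B = \bigcap_(j in [set` [set: 'I_n]%SET]) (Z j @^-1` B j).
  by apply/seteqP; split => t h j; have := h j; rewrite /= inE => + _; apply.
have prodE : (\prod_(j < n | (0 <= j)%N) P (Z j @^-1` B j) =
    \prod_(j in [set: 'I_n]%SET) P (Z j @^-1` B j))%E.
  by apply: eq_bigl => j; rewrite inE.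
have W0 t : W 0 t = 0 by rewrite /W big_pred0.
rewrite prodE -hind// -D0.
have [A0|A0] := pselect (A 0).
  rewrite (_ : W 0 @^-1` A = setT); last by apply/seteqP; split => t //= _; rewrite W0.
  by rewrite setTI probability_setT mul1e.
rewrite (_ : W 0 @^-1` A = set0); last by apply/seteqP; split => t //=; rewrite W0.
by rewrite set0I measure0 mul0e.
Qed.

Hypothesis hnorm : forall k, standard_normal (Z k).

(** The law of Z k and the normal law live on two presentations of the Borel
sigma-algebra of R, and the push-forward to the second one connects them. *)
Let normal_mean k f : measurable_fun setT f -> (forall x, (0 <= f x)%E) ->
  (\int[distribution P (Z k)]_y f y = \int[N]_y f y)%E.
Proof.
move=> mf f0; rewrite ge0_integral_distribution//.
pose X : T -> measurableTypeR R := Z k.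
have mX0 : measurable_fun setT (Z k) by exact: measurable_funPT.
have mX : measurable_fun setT X by exact: mX0.
transitivity (\int[pushforward P X]_y f y)%E.
  by rewrite (ge0_integral_pushforward mX)// => y _; exact: f0.
have e A : measurable A -> A `<=` setT -> pushforward P X A = N A.
  by move=> mA _; exact: hnorm.
by rewrite -(eq_measure_integral (pushforward P X) (fun A mA AT => esym (e A mA AT))).
Qed.

Let mean_succ k (hk : (k < n)%N) f : measurable_fun setT f -> (forall x, (0 <= f x)%E) ->
  (\int[P]_t f (W k.+1 t) = \int[P]_t chi2_mean (lambda (Ordinal hk)) f (W k t))%E.
Proof.
move=> mf f0; set o := Ordinal hk.
pose g (p : R * R) : \bar R := f (p.1 + lambda o * p.2 ^+ 2).
have mg : measurable_fun setT g.
  apply: (measurableT_comp mf); apply: measurable_funD => //; apply: measurable_funM => //.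
  by apply: measurable_funX; exact: measurable_snd.
have mpair : measurable_fun setT (fun t => (W k t, Z o t)).
  by apply/measurable_fun_pairP; split => //=.
transitivity (\int[pushforward P (fun t => (W k t, Z o t))]_p g p)%E.
  rewrite ge0_integral_pushforward//; last by move=> p _; exact: f0.
  by apply: eq_integral => t _; rewrite /g /= W_succ.
transitivity (\int[(distribution P (W k) \x distribution P (Z o))%E]_p g p)%E.
  apply: eq_measure_integral => C mC _; apply/esym.
  have := @pair_split k hk (fun=> setT) C (split_all (ltnW hk)) (fun=> measurableT) mC.
  rewrite (_ : D k.+1 _ = setT); last by apply/seteqP; split.
  rewrite setIT big1 ?mule1// => j _.
  by rewrite preimage_setT probability_setT.
rewrite fubini_tonelli1//; last by move=> p; exact: f0.
transitivity (\int[distribution P (W k)]_x chi2_mean (lambda o) f x)%E; last first.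
  apply: ge0_integral_distribution; first exact: measurable_chi2_mean.
  by move=> x; exact: chi2_mean_ge0.
apply: eq_integral => x _; rewrite /fubini_F /chi2_mean /g /=.
apply: normal_mean => //; exact: measurable_chi2_arg.
Qed.

Lemma weighted_chi2_mean f : measurable_fun setT f -> (forall x, (0 <= f x)%E) ->
  (\int[P]_t f (weighted_chi2 lambda Z t) =
   chi2s_mean [seq lambda k | k <- enum 'I_n] f 0)%E.
Proof.
move=> mf f0; pose L := [seq lambda k | k <- enum 'I_n].
have szL : size L = n by rewrite size_map size_enum_ord.
have step k : (k <= n)%N -> forall g, measurable_fun setT g -> (forall x, (0 <= g x)%E) ->
    (\int[P]_t g (W k t) = chi2s_mean (take k L) g 0)%E.
  elim: k => [_ g mg g0|k IH hk g mg g0].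
    rewrite take0 /= (_ : (fun t => g (W 0 t)) = cst (g 0)); last first.
      by apply/funext => t; rewrite /W big_pred0.
    by rewrite integral_cst// [X in (_ * X)%E]probability_setT mule1.
  rewrite (mean_succ hk mg g0) IH ?(ltnW hk)//.
  - rewrite (take_nth 0) ?szL// /chi2s_mean -cats1 foldr_cat /=.
    by rewrite (nth_map (Ordinal hk)) ?size_enum_ord// (nth_ord_enum (Ordinal hk) (Ordinal hk)).
  - exact: measurable_chi2_mean.
  - by move=> x; exact: chi2_mean_ge0.
have := step n (leqnn n) f mf f0; rewrite take_oversize ?szL// => <-.
apply: eq_integral => t _; congr f; rewrite /weighted_chi2 /W.
by apply: eq_bigl => i; rewrite ltn_ord.
Qed.
End Transfer.

(** * Densities and their supremum *)

Section Final.
Variable R : realType.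
Local Notation mu := (@lebesgue_measure R).

Lemma inv_root4E (x : R) : 0 < x -> inv_root4 x = ((Num.sqrt (Num.sqrt x))^-1)%:E.
Proof.
move=> x0; rewrite /inv_root4 gt_eqF// powRN -(powR12_sqrt (sqrtr_ge0 x)) -(powR12_sqrt (ltW x0)).
by rewrite -powRrM; congr (_ `^ _)^-1%:E; field.
Qed.

(** If p exceeded M at a point, continuity would make it exceed M by a fixed
amount on an interval around this point. *)
Lemma max_density_le (p : R -> R) (M : R) :
  measurable_fun setT p -> (forall x, 0 <= p x) ->
  (forall x, 0 < x -> {for x, continuous p}) ->
  (forall a b, a <= b -> (\int[mu]_(x in `[a, b]) (p x)%:E <= (M * (b - a))%:E)%E) ->
  (max_density p <= M%:E)%E.
Proof.
move=> mp p0 cp hM; apply: ge_ereal_sup => _ [x /= x0 <-]; rewrite lee_fin.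
rewrite leNgt; apply/negP => Mp.
pose h := (p x - M) / 2; have h0 : 0 < h by rewrite divr_gt0// subr_gt0.
have /cvgrPdist_lt /(_ h h0) [e /= e0 he] := cp x x0.
have near y : `|x - y| <= e / 2 -> M + h <= p y.
  move=> xy; have : `|x - y| < e by apply: le_lt_trans xy _; rewrite ltr_pdivrMr// ltr_pMr// ltr1n.
  by move=> /he; rewrite ltr_norml /h => /andP[_]; lra.
have ab : x - e / 2 <= x + e / 2 by lra.
have := hM _ _ ab; apply/negP; rewrite -ltNge.
apply: (@lt_le_trans _ _ (\int[mu]_(y in `[(x - e / 2)%R, (x + e / 2)%R]) (M + h)%:E)%E).
  rewrite integral_cst//= [X in (_ * X)%E]lebesgue_measure_itv/= lte_fin.
  rewrite ifT; last by lra.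
  rewrite -EFinD -EFinM lte_fin ltr_pM2r ?ltrDl//; lra.
have M0 : 0 <= M.
  rewrite -lee_fin (_ : M = M * (1 - 0)); last by rewrite subr0 mulr1.
  apply: le_trans (hM 0 1 ler01).
  by apply: integral_ge0 => y _; rewrite lee_fin.
have Mh0 : 0 <= M + h by rewrite addr_ge0// ltW.
apply: ge0_le_integral => //.
- by apply/measurable_EFinP; exact: measurable_funTS.
- move=> y /=; rewrite in_itv/= lee_fin => /andP[h1 h2]; apply: near.
  by rewrite ler_norml; apply/andP; split; lra.
Qed.

(** On the positive half-line p is at most D, and the negative half-line
carries no mass. *)
Lemma integral_density_le (p : R -> R) (D a b : R) :
  measurable_fun setT p -> (forall x, 0 <= p x) ->
  (\int[mu]_(x in `]-oo, 0%R[) (p x)%:E = 0)%E ->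
  (forall x, 0 < x -> p x <= D) -> a <= b ->
  (\int[mu]_(x in `[a, b]) (p x)%:E <= (D * (b - a))%:E)%E.
Proof.
move=> mp p0 pneg pD ab.
have D0 : 0 <= D by apply: le_trans (p0 1) _; exact: pD.
pose g (x : R) : \bar R := ((fun x => (p x)%:E) \_ `]-oo, 0%R]) x.
have mg : measurable_fun setT g.
  apply: (iffLR (measurable_restrictT _ _)) => //; apply/measurable_EFinP.
  exact: measurable_funTS.
have g0 x : (0 <= g x)%E by rewrite /g patchE; case: ifP => _ //; rewrite lee_fin.
apply: (@le_trans _ _ (\int[mu]_(x in `[a, b]) (g x + D%:E))%E).
  apply: ge0_le_integral => //.
  - by move=> x _; rewrite lee_fin.
  - by apply/measurable_EFinP; exact: measurable_funTS.
  - by apply: measurable_funTS; exact: emeasurable_funD.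
  - move=> x _; rewrite /g patchE mem_setE in_itv/=.
    case: ifP => [_|/negbT]; first by rewrite leeDl.
    by rewrite -ltNge add0e lee_fin; exact: pD.
rewrite ge0_integralD//; last exact: measurable_funTS.
rewrite [X in (X + _)%E](_ : _ = 0)%E; last first.
  apply/eqP; rewrite eq_le integral_ge0// andbT.
  apply: (@le_trans _ _ (\int[mu]_x g x)%E); first by apply: ge0_subset_integral.
  rewrite /g -integral_mkcond -integral_itv_bndo_bndc ?pneg//.
  by apply/measurable_EFinP; exact: measurable_funTS.
rewrite add0e integral_cst//= [X in (_ * X)%E]lebesgue_measure_itv/= lte_fin.
case: ltP => hd; first by rewrite -EFinD -EFinM.
by rewrite mule0 lee_fin mulr_ge0// subr_ge0.
Qed.

Lemma max_density_ge0 (p : R -> R) : (forall x, 0 <= p x) -> (0 <= max_density p)%E.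
Proof.
move=> p0; apply: (@le_trans _ _ (p 1)%:E); first by rewrite lee_fin.
by apply: ereal_sup_ubound; exists 1 => //=.
Qed.

Lemma max_density_real (p : R -> R) (D : R) : max_density p = D%:E ->
  forall x, 0 < x -> p x <= D.
Proof.
move=> pD x x0; rewrite -lee_fin -pD.
by apply: ereal_sup_ubound; exists x.
Qed.

(** Splits off the largest coefficient, to match the recursive form of the
averages. *)
Lemma coefficient_seq n (lambda : 'I_n -> R) : (0 < n)%N ->
  (forall i j : 'I_n, (i <= j)%N -> lambda j <= lambda i) ->
  (forall k, 0 < lambda k) ->
  exists l s, [/\ [seq lambda k | k <- enum 'I_n] = l :: s,
    path >=%R l s, forall k, k \in l :: s -> 0 < k,
    \sum_(k < n) lambda k ^+ 2 = l ^+ 2 + \sum_(k <- s) k ^+ 2 &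
    \sum_(k < n | (1 <= k)%N) lambda k ^+ 2 = \sum_(k <- s) k ^+ 2].
Proof.
case: n lambda => // n lambda _ hmono hpos.
exists (lambda ord0), [seq lambda (lift ord0 k) | k <- enum 'I_n].
have LE : [seq lambda k | k <- enum 'I_n.+1] =
    lambda ord0 :: [seq lambda (lift ord0 k) | k <- enum 'I_n].
  by rewrite enum_ordSl /= -map_comp.
have sumE : \sum_(k <- [seq lambda (lift ord0 k) | k <- enum 'I_n]) k ^+ 2 =
    \sum_(k < n) lambda (lift ord0 k) ^+ 2 by rewrite big_map big_enum.
split => //.
- rewrite -[path _ _ _]/(sorted >=%R (lambda ord0 :: _)) -LE.
  apply/(sortedP 0) => i; rewrite size_map size_enum_ord => hi.
  have nthE j (hj : (j < n.+1)%N) : [seq lambda k | k <- enum 'I_n.+1]`_j = lambda (Ordinal hj).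
    rewrite (nth_map ord0) ?size_enum_ord//; congr lambda.
    exact: (nth_ord_enum ord0 (Ordinal hj)).
  by rewrite (nthE _ hi) (nthE _ (ltnW hi)) /=; apply: hmono => /=.
- by move=> k; rewrite -LE => /mapP[j _ ->].
- by rewrite big_ord_recl sumE.
- by rewrite big_mkcond big_ord_recl/= add0r sumE; apply: eq_bigr => k _.
Qed.

End Final.

(** * The two-sided estimate *)

Theorem theorem1 (R : realType) (d : measure_display) (T : measurableType d)
    (P : probability T R) (n : nat) (hn : (1 <= n)%N)
    (Z : 'I_n -> {RV P >-> R})
    (hind : mutually_independent Z)
    (hnorm : forall k, standard_normal (Z k))
    (lambda : 'I_n -> R)
    (hmono : forall i j : 'I_n, (i <= j)%N -> lambda j <= lambda i)
    (hpos : forall k, 0 < lambda k)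
    (p : R -> R)
    (hp : density_continuous_on_pos P (weighted_chi2 lambda Z) p) :
  let A1 := \sum_(k < n) lambda k ^+ 2 in
  let A2 := \sum_(k < n | (1 <= k)%N) lambda k ^+ 2 in
  let c0 : R := 1 / (4 * expR 1 ^+ 2 * Num.sqrt (2 * pi)) in
  let c1 : R := 2 / Num.sqrt pi in
  [/\ (c0%:E * inv_root4 (A1 * A2) <= max_density p)%E,
      (max_density p <= c1%:E * inv_root4 (A1 * A2))%E,
      13 / 1000 < c0 &
      c1 < 1129 / 1000].
Proof.
move=> A1 A2 c0 c1.
have c0_gt0 : 0 < c0 by apply: lt_trans (c0_gt R); clear; lra.
have c1_gt0 : 0 < c1 by rewrite /c1 divr_gt0// sqrtr_gt0 pi_gt0.
case: hp => mp p0 pE cp.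
pose W := weighted_chi2 lambda Z.
have meanE := weighted_chi2_mean lambda hind hnorm.
have mW : measurable_fun setT W.
  apply: (@measurable_sum _ _ _ _ _ _ (fun (k : 'I_n) t => lambda k * Z k t ^+ 2)) => k.
  by apply: measurable_funM => //; apply: measurable_funX.
have prob_itv a b : (\int[lebesgue_measure]_(x in `[a, b]) (p x)%:E =
    chi2s_mean [seq lambda k | k <- enum 'I_n] (fun y => (\1_`[a, b] y)%:E) 0)%E.
  rewrite -pE; last exact: measurable_itv.
  rewrite -meanE; [|exact: measurable_EFin_indic_itv|by move=> y; rewrite lee_fin].
  have mWab : measurable (W @^-1` `[a, b]).
    by rewrite -[_ @^-1` _]setTI; apply: mW => //; exact: measurable_itv.
  transitivity (\int[P]_t (\1_(W @^-1` `[a, b]) t)%:E)%E; first by rewrite integral_indic// setIT.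
  by apply: eq_integral => t _; rewrite !indicE.
have pneg : (\int[lebesgue_measure]_(x in `]-oo, 0%R[) (p x)%:E = 0)%E.
  rewrite -pE; last exact: measurable_itv.
  rewrite /pushforward (_ : _ @^-1` _ = set0) ?measure0//.
  apply/seteqP; split => t //=; rewrite in_itv/= => W0.
  have : 0 <= weighted_chi2 lambda Z t.
    by apply: sumr_ge0 => k _; rewrite mulr_ge0 ?sqr_ge0// ltW.
  by rewrite leNgt W0.
have [l [s [LE sorted_s pos_s A1E0 A2E0]]] := coefficient_seq hn hmono hpos.
have A2E : A2 = \sum_(k <- s) k ^+ 2 := A2E0.
have A1E : A1 = l ^+ 2 + \sum_(k <- s) k ^+ 2 := A1E0.
move: A1 A2 A1E A2E {A1E0 A2E0} => A1 A2 A1E A2E.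
rewrite LE in prob_itv.
have l0 : 0 < l by apply: pos_s; rewrite mem_head.
have s_pos k : k \in s -> 0 < k by move=> ks; apply: pos_s; rewrite inE ks orbT.
have max0 := max_density_ge0 p0.
(* the interval [S - 8 tau, S + 9 tau] may reach below 0, where p has no mass *)
have lower D tau r : max_density p = D%:E -> 0 < tau -> A2 <= tau ^+ 2 ->
    0 <= r -> r * tau <= 1 -> r ^+ 2 * (tau * l) <= 1 -> c0 * r <= D.
  move=> DE t0 At r0 rt rl.
  have := mass_lower erefl l0 t0 s_pos _ r0 rt rl; rewrite -A2E => /(_ At).
  rewrite -prob_itv => h; have t17 : 0 < 17 * tau by rewrite mulr_gt0.
  set S := \sum_(k <- s) k in h.
  have := @integral_density_le _ p D (S - 8 * tau) (S + 9 * tau) mp p0 pneg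
    (max_density_real DE).
  rewrite (_ : S + 9 * tau - (S - 8 * tau) = 17 * tau); last by ring.
  move=> /(_ _)/(le_trans h); rewrite lee_fin ler_pM2r//; apply; lra.
split; [| |exact: c0_gt|exact: c1_lt].
  have A12 : A2 <= A1 by rewrite A1E -A2E lerDr sqr_ge0.
  have [A20|A20] := eqVneq A2 0.
    rewrite /inv_root4 A20 mulr0 eqxx gt0_muley ?lte_fin//.
    case maxE : (max_density p) max0 => [D| |]// _; exfalso.
    pose r := Num.max l^-1 ((D + 1) / c0).
    have r0 : 0 < r by rewrite lt_max invr_gt0 l0.
    have rl : l^-1 <= r by rewrite le_max lexx.
    have rD : (D + 1) / c0 <= r by rewrite le_max lexx orbT.
    have r2l : 0 < r ^+ 2 * l by rewrite mulr_gt0// exprn_gt0.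
    have : c0 * r <= D.
      apply: (lower D (r ^+ 2 * l)^-1 r maxE) => //.
      - by rewrite invr_gt0.
      - by rewrite A20 sqr_ge0.
      - exact: ltW.
      - rewrite ler_pdivrMr// mul1r expr2 -mulrA ler_peMr ?(ltW r0)//.
        by rewrite -ler_pdivrMr// div1r.
      - by rewrite mulrCA mulrC divff ?gt_eqF.
    by move: rD; rewrite ler_pdivrMr// mulrC => rD; lra.
  have A2p : 0 < A2.
    by rewrite lt0r A20 A2E /= sumr_ge0// => k _; exact: sqr_ge0.
  have A1p : 0 < A1 by rewrite A1E -A2E ltr_wpDl// ?sqr_ge0.
  rewrite inv_root4E ?mulr_gt0//.
  case maxE : (max_density p) max0 => [D| |]//; last by move=> _; exact: leey.
  rewrite -EFinM lee_fin => _; apply: (lower D (Num.sqrt A2) _ maxE).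
  - by rewrite sqrtr_gt0.
  - by rewrite sqr_sqrtr// ltW.
  - by rewrite invr_ge0 sqrtr_ge0.
  - rewrite mulrC ler_pdivrMr ?sqrtr_gt0 ?mulr_gt0// mul1r.
    by rewrite ler_wsqrtr// -[leLHS]ger0_norm ?(ltW A2p)// -sqrtr_sqr ler_wsqrtr// expr2 ler_wpM2r ?(ltW A2p).
  - rewrite exprVn sqr_sqrtr ?sqrtr_ge0// mulrC ler_pdivrMr ?sqrtr_gt0 ?mulr_gt0// mul1r.
    rewrite mulrC -{1}[l]ger0_norm ?(ltW l0)// -sqrtr_sqr -sqrtrM ?sqr_ge0//.
    by rewrite ler_wsqrtr// ler_wpM2r ?(ltW A2p)// A1E lerDl -A2E ltW.
have [A20|A20] := eqVneq A2 0.
  by rewrite /inv_root4 A20 mulr0 eqxx gt0_muley ?lte_fin// leey.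
case: s => [|m s] in LE sorted_s pos_s A1E A2E prob_itv s_pos lower *.
  by rewrite A2E big_nil eqxx in A20.
have A2p : 0 < A2.
    by rewrite lt0r A20 A2E /= sumr_ge0// => k _; exact: sqr_ge0.
have A1p : 0 < A1 by rewrite A1E -A2E ltr_wpDl// ?sqr_ge0.
rewrite inv_root4E ?mulr_gt0// -EFinM; apply: max_density_le => // a b ab.
rewrite prob_itv.
have m0 : 0 < m by apply: s_pos; rewrite mem_head.
move: sorted_s => /=; rewrite (path_sortedE ge_trans) => /andP[ml /andP[/allP ms _]].
have ms' k : k \in s -> 0 < k <= m.
  by move=> ks; rewrite (s_pos k) ?inE ?ks ?orbT//=; exact: (ms k ks).
have := density_le_upper m0 ml ms'.
rewrite /= A1E A2E big_cons => h; exact: h.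
Qed.
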